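(* For every integer $l>4$, with all sums ranging over the quadruples $(l_1,l_2,l_3,l_4)$ of positive integers with $l_1\ge2$ and $l_1+l_2+l_3+l_4=l$, the following hold: $$\sum\zeta(l_1,l_2,l_3,l_4)=\zeta(l),$$ $$\sum\bigl(2^{l_1+l_2+l_3-2}+2^{l_1+l_2-2}+2^{l_1-1}-2^{l_2+l_3-1}-2^{l_2-1}\bigr)\zeta(l_1,l_2,l_3,l_4)=l\,\zeta(l),$$ $$\sum\bigl(2^{l_1}+2^{l_3+1}\bigr)\zeta(l_1,l_2,l_3,l_4)=(l+3)\,\zeta(l),$$ $$\sum\bigl(3^{l_2}2^{l_1-1}-3^{l_2}-1\bigr)2^{l_1+l_3}\,\zeta(l_1,l_2,l_3,l_4)=\Bigl(\frac{(l+7)(l+2)(l-3)}{12}+2\Bigr)\zeta(l).$$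
   Context: For positive integers $l_1\ge 2$, $l_2,\dots,l_r\ge1$, the multiple zeta value is $\zeta(l_1,\dots,l_r)=\sum_{m_1>m_2>\cdots>m_r>0}\frac{1}{m_1^{l_1}m_2^{l_2}\cdots m_r^{l_r}}$; $\zeta(l)$ is the case $r=1$ (Riemann zeta value). *)

(* Defs.v *)
From HB Require Import structures.
From mathcomp Require Import all_boot all_order all_algebra.
From mathcomp Require Import all_classical all_reals all_analysis.

Set Implicit Arguments.
Unset Strict Implicit.
Unset Printing Implicit Defensive.

Import Order.TTheory GRing.Theory Num.Theory.

Local Open Scope classical_set_scope.
Local Open Scope ring_scope.

(* [sorted gtn m] says that the sequence m is strictly decreasing. *)
Definition mzv_index (r : nat) : set (r.-tuple nat) :=
  [set m : r.-tuple nat | sorted gtn m /\ all (ltn 0) m].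

Definition mzv_term (R : realType) (r : nat) (s m : r.-tuple nat) : R :=
  \prod_(i < r) ((tnth m i)%:R ^+ tnth s i)^-1.

(* All the terms are nonnegative, so the series is an unordered sum in \bar R;
   it is finite when all the entries of s are positive and the first one is at
   least 2. Outside that range [fine] may return the junk value 0. *)
Definition mzv (R : realType) (r : nat) (s : r.-tuple nat) : R :=
  fine (\esum_(m in @mzv_index r) (mzv_term R s m)%:E).

Definition zeta (R : realType) (n : nat) : R := mzv R [tuple n].

(* The bounds l_i < l.+1 only make the index type finite: they follow from
   l1 + l2 + l3 + l4 = l. *)
Definition sum_quad (R : realType) (l : nat)
    (F : nat -> nat -> nat -> nat -> R) : R :=
  \sum_(l1 < l.+1) \sum_(l2 < l.+1) \sum_(l3 < l.+1)
    \sum_(l4 < l.+1 | [&& 2 <= l1, 1 <= l2, 1 <= l3, 1 <= l4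
                        & l1 + l2 + l3 + l4 == l]%N)
      F l1 l2 l3 l4.

(* Main.v *)
Require Import Defs.
From HB Require Import structures.
From mathcomp Require Import all_boot all_order all_algebra.
From mathcomp Require Import all_classical all_reals all_analysis.
From mathcomp Require Import ring lra zify.

Set Implicit Arguments.
Unset Strict Implicit.
Unset Printing Implicit Defensive.

Import Order.TTheory GRing.Theory Num.Theory.
Import numFieldNormedType.Exports.

Local Open Scope classical_set_scope.
Local Open Scope ring_scope.

(** All four identities are instances of one parametrised sum formula, which
    comes from evaluating a single fourfold sum in two ways. Put positive integers
    [m_0, ..., m_3] on a circle and consider, for [0 <= z < 1] and parameters
    [x_i >= 0],
[[
      W(m) = prod_i (z ^ m_i - [m_(i-1) > m_i]),
      sum_m W(m) * prod_i 1 / (m_i - x_i * t).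
]]
    Only the coefficient of [t ^ k] matters, where [k = l - 4 > 0] and [l] is
    the weight.

    As [z] tends to 1, [W(m)] tends to [prod_i [m_(i-1) <= m_i]], which is 1 if
    all the [m_i] are equal and 0 otherwise; so the sum tends to a multiple of
    [zeta(l)], the factor being the complete homogeneous symmetric polynomial
    of degree [k] in the [x_i] ([cyc_weight_cvg], [hsum_diagonal]). Dominated
    convergence applies because [|W(m)| <= min m / max m] for every [z]
    ([cyc_weight_bound]), because the coefficient is at most a constant over
    [min m * prod_i m_i] when [k > 0] ([gf_coef_le]), and because the sum of
    [1 / (max m * prod_i m_i)] over all [m] is finite ([hsum_dominant]).

    On the other hand, expanding the product [W(m)] cuts the circle into arcs,
    with the entries decreasing along each arc and a factor [z ^ m] for the
    largest entry of each ([cyc_weight_arcs]). In terms of the gaps between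
    consecutive entries, the weight becomes [z] to the sum of all gaps and the
    summand a product over the arcs; the partial fraction identity
    [1 / (a * b) = 1 / (a + b) * (1 / a + 1 / b)] then rewrites this product as
    a sum over shuffles ([prod_suffix_prod]), each of which is again a sum over
    [m_0 > m_1 > m_2 > m_3], hence a combination of multiple polylogarithms of
    weight [l] ([hsum_arcs]).

    The polylogarithms whose first exponent is 1 diverge as [z] tends to 1, but
    they cancel identically: their arguments are those left after removing the
    leading letter of an arc, and it makes no difference whether that letter was
    first cut off to form an arc of its own, which changes the sign. The others
    tend to multiple zeta values ([polylog_cvg]). The result is
    [cyclic_sum_formula]. The theorem is a linear combination of its instances
    at [x = (1,0,0,0), (1,1,0,0), (1,0,1,0), (1,1,1,0), (1,1,1,1)]; for these,
    the shuffles are enumerated and collected by computation ([collects]). *)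

(** * Sums of nonnegative families *)

Section Hsum.
Context {R : realType}.

Lemma cvg_finsum (I : eqType) (r : seq I) (F : I -> nat -> R) (l : I -> R) :
  (forall i, i \in r -> F i @ \oo --> l i) ->
  (fun n => \sum_(i <- r) F i n) @ \oo --> \sum_(i <- r) l i.
Proof.
elim: r => [|i r IH] H.
  by rewrite big_nil; under eq_fun do rewrite big_nil; exact: cvg_cst.
rewrite big_cons; under eq_fun do rewrite big_cons.
apply: cvgD; first by apply: H; rewrite mem_head.
by apply: IH => j jr; apply: H; rewrite inE jr orbT.
Qed.

(** An unordered sum with a certificate that it is finite: a real [s] excludes
    the value [+oo], which [fine] would send to 0. *)
Definition hsum (T : choiceType) (A : set T) (f : T -> R) (s : R) :=
  (forall x, A x -> 0 <= f x) /\ \esum_(x in A) (f x)%:E = s%:E.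

Section OneType.
Context {T : choiceType}.
Implicit Types (A B : set T) (f g : T -> R) (s t : R).

Lemma hsum_ext A f g s : (forall x, A x -> f x = g x) -> hsum A f s -> hsum A g s.
Proof.
move=> fg [f0 fs]; rewrite /hsum -fs; split=> [x Ax|]; first by rewrite -fg ?f0.
by apply: eq_esum => x Ax; rewrite fg.
Qed.

Lemma hsum_uniq A f s t : hsum A f s -> hsum A f t -> s = t.
Proof. by move=> [_ h] [_]; rewrite h => -[]. Qed.

Lemma hsum_ge0 A f s : hsum A f s -> 0 <= s.
Proof.
by move=> [f0 fs]; rewrite -lee_fin -fs esum_ge0 // => x /f0; rewrite lee_fin.
Qed.

Lemma hsumD A f g s t :
  hsum A f s -> hsum A g t -> hsum A (fun x => f x + g x) (s + t).
Proof.
move=> [f0 fs] [g0 gt]; split=> [x Ax|]; first by rewrite addr_ge0 ?f0 ?g0.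
under eq_esum do rewrite EFinD.
by rewrite esumD ?fs ?gt // => x Ax; rewrite lee_fin ?f0 ?g0.
Qed.

Lemma hsum0 A : hsum A (fun=> 0) 0.
Proof. by split=> //; rewrite esum1. Qed.

Lemma hsumZ A f s c : 0 <= c -> hsum A f s -> hsum A (fun x => c * f x) (c * s).
Proof.
move=> c0 [f0 fs]; split=> [x Ax|]; first by rewrite mulr_ge0 ?f0.
rewrite EFinM -fs /esum -ereal_supZl //; last first.
  apply/set0P; eexists; exists set0; first exact: fsets_set0.
  by rewrite fsbig_set0.
congr ereal_sup; apply/seteqP; split=> y /=.
  move=> [X XA <-]; eexists; first by exists X.
  case: XA => finX _; rewrite !fsbig_finite//= !sumEFin -EFinM.
  by rewrite mulr_sumr.
move=> [_ [X XA <-] <-]; exists X => //.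
case: XA => finX _; rewrite !fsbig_finite//= !sumEFin -EFinM.
by rewrite mulr_sumr.
Qed.

Lemma hsum_sum A (I : eqType) (r : seq I) (F : I -> T -> R) (S : I -> R) :
  (forall i, i \in r -> hsum A (F i) (S i)) ->
  hsum A (fun x => \sum_(i <- r) F i x) (\sum_(i <- r) S i).
Proof.
elim: r => [|i r IH] H.
  by rewrite big_nil; apply: (hsum_ext _ (hsum0 A)) => x _; rewrite big_nil.
rewrite big_cons; apply: (hsum_ext (f := fun x => F i x + \sum_(i <- r) F i x)).
  by move=> x _; rewrite big_cons.
apply: hsumD; first by apply: H; rewrite mem_head.
by apply: IH => j jr; apply: H; rewrite inE jr orbT.
Qed.

Lemma hsum_dom A f g t : (forall x, A x -> 0 <= f x <= g x) -> hsum A g t ->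
  exists2 s, hsum A f s & s <= t.
Proof.
move=> fg [g0 gt].
have f0 x : A x -> 0 <= f x by case/fg/andP.
have le : (\esum_(x in A) (f x)%:E <= t%:E)%E.
  by rewrite -gt; apply: le_esum => x /fg /andP[_]; rewrite lee_fin.
have ge : (0 <= \esum_(x in A) (f x)%:E)%E.
  by apply: esum_ge0 => x /f0; rewrite lee_fin.
exists (fine (\esum_(x in A) (f x)%:E)).
  by split=> //; rewrite fineK // ge0_fin_numE // (le_lt_trans le) // ltry.
by rewrite -lee_fin fineK // ge0_fin_numE // (le_lt_trans le) // ltry.
Qed.

Lemma hsumB A f g s t : (forall x, A x -> 0 <= f x <= g x) ->
  hsum A f s -> hsum A g t -> hsum A (fun x => g x - f x) (t - s).
Proof.
move=> fg hf hg.
have [|d hd _] := @hsum_dom A (fun x => g x - f x) g t _ hg.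
  by move=> x /fg /andP[f0 fg']; rewrite subr_ge0 fg' gerBl.
have /hsum_uniq : hsum A g (s + d).
  by apply: hsum_ext (hsumD hf hd) => x _; rewrite subrKC.
by move=> /(_ _ hg) <-; rewrite addrC addKr.
Qed.

Lemma hsum_restrict A B f s :
  hsum (A `&` B) f s <->
  hsum A (fun x => (x \in B)%:R * f x) s.
Proof.
have E : \esum_(x in A `&` B) (f x)%:E =
         \esum_(x in A) ((x \in B)%:R * f x)%:E.
  rewrite esum_mkcondr; apply: eq_esum => x _.
  by case: ifP => _; rewrite ?mul1r ?mul0r.
rewrite /hsum E; split=> -[f0 h]; split=> //.
  by move=> x Ax; case: (boolP (x \in B)) => [/set_mem Bx|]; rewrite ?mul0r ?mul1r ?f0.
by move=> x [Ax Bx]; have := f0 x Ax; rewrite mem_set // mul1r.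
Qed.

Lemma hsum_subset A B f s : B `<=` A -> hsum A f s ->
  exists2 t, hsum B f t & t <= s.
Proof.
move=> BA [f0 fs].
have [||t ht le] := @hsum_dom A (fun x => (x \in B)%:R * f x) f s.
- by move=> x Ax; case: (x \in B); rewrite ?mul1r ?mul0r ?lexx ?f0.
- by split.
exists t => //; have -> : B = A `&` B by rewrite setIC; apply/esym/setIidl.
exact/hsum_restrict.
Qed.

(** A finite sum already comes within [e] of the limit, and finitely many terms
    converge together. *)
Lemma hsum_lsc A (F : nat -> T -> R) f (S : nat -> R) s :
  (forall x, A x -> (F ^~ x) @ \oo --> f x) ->
  (forall n, hsum A (F n) (S n)) -> hsum A f s ->
  forall e, 0 < e -> \forall n \near \oo, s - e < S n.
Proof.
move=> cF hF [f0 fs] e e0.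
have : ((s - e / 2)%:E < \esum_(x in A) (f x)%:E)%E.
  by rewrite fs lte_fin gtrBl divr_gt0.
move=> /ereal_sup_gt[_ [X [finX XA] <-]].
rewrite fsbig_finite //= sumEFin lte_fin.
set r := finmap.enum_fset _ => lt.
have cX : (fun n => \sum_(x <- r) F n x) @ \oo --> \sum_(x <- r) f x.
  by apply: cvg_finsum => x; rewrite in_fset_set // => /set_mem /XA /cF.
have near_lt := cvgr_gt _ cX.
have : \sum_(x <- r) f x - e / 2 < \sum_(x <- r) f x.
  by rewrite gtrBl divr_gt0.
move=> /near_lt; apply: filterS => n ltn.
have le : \sum_(x <- r) F n x <= S n.
  case: (hF n) => F0 Fs; rewrite -lee_fin -Fs -sumEFin -fsbig_finite //.
  by apply: ereal_sup_ubound; exists X.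
lra.
Qed.

(** Lower semicontinuity applied to [F n] and to [g - F n]. *)
Lemma hsum_dominated A (F : nat -> T -> R) f g (S : nat -> R) t :
  (forall x, A x -> (F ^~ x) @ \oo --> f x) ->
  (forall n x, A x -> 0 <= F n x <= g x) -> hsum A g t ->
  (forall n, hsum A (F n) (S n)) ->
  exists2 s, hsum A f s & S @ \oo --> s.
Proof.
move=> cF bF hg hF.
have bf x : A x -> 0 <= f x <= g x.
  move=> Ax; apply/andP; split.
    apply: (cvgr_to_ge (cF x Ax)) => //; apply: nearW => n.
    by case/andP: (bF n x Ax).
  apply: (cvgr_to_le (cF x Ax)) => //; apply: nearW => n.
  by case/andP: (bF n x Ax).
have [s hf _] := hsum_dom bf hg.
exists s => //; apply/cvgrPdist_lt => e e0.
have lo := hsum_lsc cF hF hf e0.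
have := @hsum_lsc A (fun n x => g x - F n x) (fun x => g x - f x)
  (fun n => t - S n) (t - s).
move=> /(_ _ _ _ e e0) hi; near=> n.
have h1 : s - e < S n by near: n.
have h2 : t - s - e < t - S n.
  near: n; apply: hi.
  - by move=> x Ax; apply: cvgB; [exact: cvg_cst|exact: cF].
  - by move=> n; apply: hsumB (hF n) hg => x; exact: bF.
  - exact: hsumB hf hg.
by rewrite ltr_distlC; lra.
Unshelve. all: by end_near. Qed.

End OneType.

Lemma hsum_reindex (T T' : choiceType) (A : set T) (B : set T') (e : T -> T') f s :
  set_bij A B e -> hsum B f s <-> hsum A (f \o e) s.
Proof.
move=> bij; rewrite /hsum (reindex_esum A B e) //.
split=> -[f0 h]; split=> //.
  by move=> x Ax; apply: f0; case: bij => h' _ _; exact: h'.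
move=> y By; case: bij => _ _ /(_ y By) [x Ax <-]; exact: f0.
Qed.

End Hsum.

(** * Shuffles and partial fractions *)

Fixpoint shuffle (T : Type) (u v : seq T) {struct u} : seq (seq T) :=
  if u is a :: u' then
    (fix shuffle_u v := if v is b :: v' then
         [seq a :: w | w <- shuffle u' v] ++ [seq b :: w | w <- shuffle_u v']
       else [:: u]) v
  else [:: v].

Lemma shuffle_cons (T : Type) (a b : T) u v :
  shuffle (a :: u) (b :: v) =
  [seq a :: w | w <- shuffle u (b :: v)] ++ [seq b :: w | w <- shuffle (a :: u) v].
Proof. by []. Qed.

Lemma shuffles0 (T : Type) (u : seq T) : shuffle u [::] = [:: u].
Proof. by case: u. Qed.

Lemma shuffle_ind2 (T : Type) (P : seq T -> seq T -> Prop) :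
  (forall v, P [::] v) -> (forall u, P u [::]) ->
  (forall a u b v, P u (b :: v) -> P (a :: u) v -> P (a :: u) (b :: v)) ->
  forall u v, P u v.
Proof.
move=> P0 P1 IH u; elim: u => [//|a u IHu] v; elim: v => [//|b v IHv].
exact: IH.
Qed.

Lemma shuffle_perm (T : eqType) (u v w : seq T) :
  w \in shuffle u v -> perm_eq w (u ++ v).
Proof.
move: u v w; apply: shuffle_ind2 => [v|u|a u b v IH1 IH2] w.
- by rewrite inE => /eqP ->.
- by rewrite shuffles0 inE cats0 => /eqP ->.
rewrite shuffle_cons mem_cat => /orP[] /mapP[w' w'in ->].
  by rewrite cat_cons perm_cons IH1.
rewrite perm_sym -(cat1s b v) perm_catCA cat1s perm_cons perm_sym.
exact: IH2.
Qed.

Lemma map_shuffle (T U : Type) (f : T -> U) u v :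
  shuffle (map f u) (map f v) = [seq map f w | w <- shuffle u v].
Proof.
move: u v; apply: shuffle_ind2 => [v //|u|a u b v IH1 IH2]; first by rewrite !shuffles0.
rewrite !map_cons !shuffle_cons map_cat -!map_cons IH1 IH2 -!map_comp.
by [].
Qed.

Fixpoint shuffles (T : Type) (ws : seq (seq T)) : seq (seq T) :=
  if ws is w :: ws' then flatten [seq shuffle w u | u <- shuffles ws']
  else [:: [::]].

Lemma shuffles_perm (T : eqType) (ws : seq (seq T)) w :
  w \in shuffles ws -> perm_eq w (flatten ws).
Proof.
elim: ws w => [|u ws IH] w /=; first by rewrite inE => /eqP ->.
move=> /flatten_mapP[v vin /shuffle_perm] /perm_trans; apply.
by rewrite perm_cat2l IH.
Qed.

Lemma map_shuffles (T U : Type) (f : T -> U) ws :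
  shuffles (map (map f) ws) = [seq map f w | w <- shuffles ws].
Proof.
elim: ws => [//|w ws IH] /=; rewrite IH map_flatten -!map_comp.
by congr flatten; apply: eq_map => u /=; rewrite map_shuffle.
Qed.

Section PartialFractions.
Context {V : nmodType} {A : comNzRingType} (inv : V -> A) (D : V -> Prop).
Context (D_add : forall u v, D u -> D v -> D (u + v)).
Context (invM : forall u v, D u -> D v ->
  inv u * inv v = inv (u + v) * (inv u + inv v)).

(** With [inv u = 1 / u], this is [1 / ((u_1 + ... + u_n) ... (u_(n-1) + u_n) u_n)],
    the summand of a multiple zeta value in terms of the gaps between its
    indices. *)
Fixpoint suffix_prod (w : seq V) : A :=
  if w is a :: w' then inv (\sum_(u <- w) u) * suffix_prod w' else 1.

Lemma D_sum a w : (forall x, x \in a :: w -> D x) -> D (\sum_(u <- a :: w) u).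
Proof.
elim: w a => [|b w IH] a H.
  by rewrite big_seq1; apply: H; rewrite mem_head.
rewrite big_cons; apply: D_add; first by apply: H; rewrite mem_head.
by apply: IH => x xin; apply: H; rewrite inE xin orbT.
Qed.

(** The full sums of the two words are combined by
    [1 / (a * b) = 1 / (a + b) * (1 / a + 1 / b)], after which each of the two
    terms has lost the first letter of one of the words. *)
Lemma suffix_prod_shuffle u v :
  (forall x, x \in u ++ v -> D x) ->
  suffix_prod u * suffix_prod v = \sum_(w <- shuffle u v) suffix_prod w.
Proof.
move: u v; apply: shuffle_ind2 => [v|u|a u b v IH1 IH2] H.
- by rewrite big_seq1 mul1r.
- by rewrite shuffles0 big_seq1 mulr1.
have sub1 x : x \in u ++ b :: v -> D x.
  by move=> xin; apply: H; rewrite cat_cons inE xin orbT.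
have sub2 x : x \in (a :: u) ++ v -> D x.
  move=> xin; apply: H; move: xin; rewrite !mem_cat => /orP[->//|xv].
  by rewrite [x \in b :: v]inE xv !orbT.
have Da : D (\sum_(x <- a :: u) x).
  by apply: D_sum => x xin; apply: H; rewrite mem_cat xin.
have Db : D (\sum_(x <- b :: v) x).
  by apply: D_sum => x xin; apply: H; rewrite mem_cat xin orbT.
rewrite shuffle_cons big_cat !big_map /=.
set S := inv (\sum_(x <- a :: u) x + \sum_(x <- b :: v) x).
have -> : \sum_(w <- shuffle u (b :: v)) inv (\sum_(x <- a :: w) x) * suffix_prod w
   = S * (suffix_prod u * suffix_prod (b :: v)).
  rewrite IH1 // mulr_sumr; apply: eq_big_seq => w /shuffle_perm pw.
  congr (inv _ * _); rewrite big_cons (perm_big _ pw) big_cat /=.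
  by rewrite [in RHS]big_cons addrA.
have -> : \sum_(w <- shuffle (a :: u) v) inv (\sum_(x <- b :: w) x) * suffix_prod w
   = S * (suffix_prod (a :: u) * suffix_prod v).
  rewrite IH2 // mulr_sumr; apply: eq_big_seq => w /shuffle_perm pw.
  congr (inv _ * _); rewrite big_cons (perm_big _ pw) big_cat /=.
  by rewrite [X in _ = _ + X]big_cons addrCA.
rewrite -mulrDr /=.
have := invM Da Db; rewrite -/S => E.
transitivity (inv (\sum_(x <- a :: u) x) * inv (\sum_(x <- b :: v) x) *
  (suffix_prod u * suffix_prod v)); first by ring.
by rewrite E; ring.
Qed.

Lemma prod_suffix_prod ws :
  (forall x, x \in flatten ws -> D x) ->
  \prod_(w <- ws) suffix_prod w = \sum_(w <- shuffles ws) suffix_prod w.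
Proof.
elim: ws => [|w ws IH] H; first by rewrite big_nil big_seq1.
rewrite big_cons IH; last by move=> x xin; apply: H; rewrite mem_cat xin orbT.
rewrite mulr_sumr /= big_flatten /= big_map; apply: eq_big_seq => u uin.
apply: suffix_prod_shuffle => x; rewrite mem_cat => /orP[xin|xin].
  by apply: H; rewrite mem_cat xin.
by apply: H; rewrite mem_cat -(perm_mem (shuffles_perm uin)) xin orbT.
Qed.

End PartialFractions.

(** * Geometric series truncated after degree k *)

Section Geometric.
Context {F : fieldType} (k : nat).

(** The expansion of [1 / (m - x * 'X)] up to degree [k]. For [m = 0] it vanishes,
    as does [m^-1]. *)
Definition geom (m x : F) : {poly F} :=
  m^-1 *: \sum_(i < k.+1) ((x / m) *: 'X) ^+ i.

Lemma coef_geom (m x : F) i : (geom m x)`_i = (i <= k)%N%:R * (x ^+ i / m ^+ i.+1).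
Proof.
rewrite /geom coefZ coef_sum.
under eq_bigr do rewrite exprZn coefZ coefXn.
have [ik|ki] := leqP i k; last first.
  rewrite big1 ?mulr0 ?mul0r // => j _.
  by rewrite gtn_eqF ?mulr0 // (leq_ltn_trans _ ki) // -ltnS.
rewrite (bigD1 (Ordinal (ik : (i < k.+1)%N))) //= eqxx mulr1 big1 ?addr0.
  by rewrite mul1r expr_div_n exprS invfM mulrCA.
move=> j ne; rewrite eq_sym (_ : (j == i :> nat) = false) ?mulr0 //.
by apply: contraNF ne => /eqP E; apply/eqP/val_inj.
Qed.

Local Notation A := {poly %/ ('X^(k.+1) : {poly F})}.
Local Notation inq := (in_qpoly ('X^(k.+1) : {poly F})).

(** Modulo ['X^(k.+1)] the truncated series is a genuine inverse, so that
    identities between rational functions hold coefficientwise. *)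
Lemma geomK (m x : F) : m != 0 -> inq (m%:P - x *: 'X) * inq (geom m x) = 1.
Proof.
move=> m0; rewrite -rmorphM.
have -> : (m%:P - x *: 'X) * geom m x = 1 - (x / m) ^+ k.+1 *: 'X^(k.+1).
  rewrite /geom; set t := (x / m) *: 'X.
  have -> : m%:P - x *: 'X = m *: (1 - t).
    by rewrite scalerBr scalerA mulrCA divff // mulr1 alg_polyC.
  rewrite -scalerAl -scalerAr scalerA divff // scale1r.
  by rewrite -opprB mulNr -subrX1 opprB exprZn.
have X0 : inq 'X^(k.+1) = 0.
  by apply: val_inj; rewrite /= mk_monic_Xn Pdiv.RingMonic.rmodpp // monicXn.
have Z c : inq (c *: 'X^(k.+1)) = 0 by rewrite in_qpolyZ X0 scaler0.
by rewrite rmorphB rmorph1 [X in _ - X]Z subr0.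
Qed.

Lemma coef_inq (p : {poly F}) : (inq p : {poly F})`_k = p`_k.
Proof.
rewrite /= mk_monic_Xn /= [in RHS](Pdiv.RingMonic.rdivp_eq (monicXn _ k.+1) p).
by rewrite coefD coefMXn ltnSn add0r.
Qed.

End Geometric.

(** * A dominating family and the cyclic weight *)

Section Domination.
Context {R : realType}.
Implicit Types (z : R).

Lemma hsum_setX (T1 T2 : choiceType) (A : set T1) (B : set T2)
    (f : T1 -> R) (g : T2 -> R) s t :
  hsum A f s -> hsum B g t -> hsum (A `*` B) (fun p => f p.1 * g p.2) (s * t).
Proof.
move=> hf hg; have [f0 fs] := hf; have [g0 gt] := hg.
split=> [p [/f0 ? /g0 ?]|]; first exact: mulr_ge0.
transitivity (\esum_(x in A) \esum_(y in B) (f x * g y)%:E).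
  by rewrite esum_esum // => x y Ax By; rewrite lee_fin mulr_ge0 ?f0 ?g0.
rewrite mulrC; have [_ <-] := hsumZ (hsum_ge0 hg) hf.
by apply: eq_esum => x Ax; have [_ ->] := hsumZ (f0 x Ax) hg; rewrite mulrC.
Qed.

Lemma hsum_tuple_prod (b : nat -> R) s r :
  hsum setT b s ->
  hsum setT (fun m : r.-tuple nat => \prod_(i < r) b (tnth m i)) (s ^+ r).
Proof.
move=> hb; elim: r => [|r IH].
  split=> [x _|]; first by rewrite big_ord0.
  rewrite (_ : setT = [set [tuple]]); last first.
    by apply/seteqP; split=> x //= _; exact: tuple0.
  by rewrite esum_set1 ?lee_fin big_ord0.
have bij : set_bij [set: nat * r.-tuple nat] [set: r.+1.-tuple nat]
    (fun p => [tuple of p.1 :: p.2]).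
  split=> //.
    move=> [a u] [b' v] _ _ /= /(congr1 val) /= [-> uv].
    by congr pair; apply: val_inj.
  move=> m _ /=; case/tupleP: m => a u; exists (a, u) => //=.
rewrite (hsum_reindex _ _ bij) exprS -setXTT.
apply: hsum_ext (hsum_setX hb IH) => -[a u] _ /=.
rewrite big_ord_recl tnth0; congr (_ * _); apply: eq_bigr => i _.
by rewrite tnthS.
Qed.

Definition root4 (n : nat) : R := Num.sqrt (Num.sqrt n%:R).

Lemma root4_ge0 n : 0 <= root4 n. Proof. exact: sqrtr_ge0. Qed.

Lemma root4K n : root4 n ^+ 4 = n%:R.
Proof. by rewrite (exprM _ 2 2) !sqr_sqrtr ?sqrtr_ge0 // ler0n. Qed.

Lemma ler_root4 m n : (m <= n)%N -> root4 m <= root4 n.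
Proof. by move=> mn; rewrite !ler_wsqrtr // ler_nat. Qed.

Lemma root4_gt0 n : (0 < n)%N -> 0 < root4 n.
Proof. by move=> n0; rewrite !sqrtr_gt0 ltr0n. Qed.

(** With [p ^+ 4 = n] and [q ^+ 4 = n.+1], the factorisation
    [1 = q ^+ 4 - p ^+ 4 = (q - p) * (q + p) * (q ^+ 2 + p ^+ 2)] makes the
    terms smaller than those of a telescoping series. *)
Lemma root4_telescope n : (0 < n)%N ->
  (root4 n.+1 ^+ 5)^-1 <= 4 * ((root4 n)^-1 - (root4 n.+1)^-1).
Proof.
move=> n0; have p0 := root4_gt0 n0; have q0 := root4_gt0 (ltn0Sn n).
have pq := ler_root4 (leqnSn n).
have E : root4 n.+1 ^+ 4 = root4 n ^+ 4 + 1 by rewrite !root4K natr1.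
move: p0 q0 pq E; set p := root4 n; set q := root4 n.+1 => p0 q0 pq E.
have key : p <= 4 * (q - p) * q ^+ 4.
  have f : (q - p) * ((q + p) * (q ^+ 2 + p ^+ 2)) = 1 by ring: E.
  have le : (q + p) * (q ^+ 2 + p ^+ 2) <= (q + q) * (q ^+ 2 + q ^+ 2).
    by rewrite ler_pM ?addr_ge0 ?exprn_ge0 ?lerD ?lerXn2r ?nnegrE ?(ltW p0) ?(ltW q0).
  have : 1 <= (q - p) * ((q + q) * (q ^+ 2 + q ^+ 2)).
    by rewrite -f ler_wpM2l // subr_ge0.
  move=> /(ler_wpM2l (ltW q0)); rewrite mulr1 => h.
  apply: le_trans pq (le_trans h _).
  by rewrite le_eqVlt; apply/orP; left; apply/eqP; ring.
rewrite -subr_ge0.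
have -> : 4 * (p^-1 - q^-1) - (q ^+ 5)^-1 = (4 * (q - p) * q ^+ 4 - p) / (p * q ^+ 5).
  by field; rewrite !gt_eqF.
by rewrite divr_ge0 ?subr_ge0 // mulr_ge0 ?exprn_ge0 // ltW.
Qed.

Lemma hsum_root4 : exists s, hsum setT (fun n => (root4 n ^+ 5)^-1) s.
Proof.
set b := fun n => (root4 n ^+ 5)^-1.
have b0 n : 0 <= b n by rewrite invr_ge0 exprn_ge0 ?root4_ge0.
have r0 : root4 0 = 0 by rewrite /root4 !sqrtr0.
have r1 : root4 1 = 1 by rewrite /root4 !sqrtr1.
have bound N : \sum_(0 <= n < N.+2) b n <= 5 - 4 * (root4 N.+1)^-1.
  elim: N => [|N IH].
    rewrite !big_nat_recr //= big_nil /b r0 r1 expr0n invr0 expr1n invr1; lra.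
  rewrite big_nat_recr //=; have := root4_telescope (ltn0Sn N).
  by rewrite -/(b N.+2); lra.
have bound5 N : \sum_(0 <= n < N) b n <= 5.
  apply: (@le_trans _ _ (\sum_(0 <= n < N.+2) b n)).
    by rewrite !big_nat_recr //= -addrA lerDl addr_ge0.
  by apply: le_trans (bound N) _; rewrite gerBl mulr_ge0 // invr_ge0 root4_ge0.
have le : (\esum_(n in setT) (b n)%:E <= 5%:E)%E.
  rewrite -nneseries_esumT; last by move=> n; rewrite lee_fin.
  apply: lime_le.
    by apply: is_cvg_nneseries => n _ _; rewrite lee_fin.
  by apply: nearW => N; rewrite sumEFin lee_fin.
exists (fine (\esum_(n in setT) (b n)%:E)); split=> //.
rewrite fineK // ge0_fin_numE; last by apply: esum_ge0 => n _; rewrite lee_fin.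
by rewrite (le_lt_trans le) // ltry.
Qed.

Definition max_entry r (m : r.-tuple nat) : nat := \max_(i < r) tnth m i.

Definition dominant r (m : r.-tuple nat) : R :=
  ((max_entry m)%:R * \prod_(i < r) (tnth m i)%:R)^-1.

Lemma max_entryP r (m : r.-tuple nat) i : (tnth m i <= max_entry m)%N.
Proof. exact: (leq_bigmax i). Qed.

Lemma dominant_ge0 r (m : r.-tuple nat) : 0 <= dominant m.
Proof. by rewrite invr_ge0 mulr_ge0 ?prodr_ge0. Qed.

(** The maximum exceeds the geometric mean of the four entries, so the dominant
    is at most a product of terms [n ^ (- 5 / 4)]. *)
Lemma hsum_dominant : exists s, hsum setT (@dominant 4) s.
Proof.
have [s hs] := hsum_root4.
have [|t ht _] := @hsum_dom R _ setT (@dominant 4) _ _ _ (hsum_tuple_prod 4 hs);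
  last by exists t.
move=> m _; rewrite dominant_ge0 /=.
have [/existsP[i /eqP mi0]|] := boolP [exists i, tnth m i == 0%N].
  rewrite /dominant (bigD1 i) //= mi0 mul0r mulr0 invr0.
  by rewrite prodr_ge0 // => j _; rewrite invr_ge0 exprn_ge0 ?root4_ge0.
rewrite negb_exists => /forallP mpos.
have pos i : (0 < tnth m i)%N by rewrite lt0n mpos.
rewrite prodfV /dominant lef_pV2 ?posrE; last 2 first.
- rewrite mulr_gt0 ?prodr_gt0 // => [|i _]; rewrite ltr0n //.
  exact: leq_trans (pos ord0) (max_entryP m ord0).
- by rewrite prodr_gt0 // => i _; rewrite exprn_gt0 // root4_gt0.
under eq_bigr do rewrite exprS root4K.
rewrite big_split /= ler_wpM2r ?prodr_ge0 // -root4K.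
rewrite -[X in _ ^+ X]card_ord -prodr_const ler_prod // => i _.
by rewrite root4_ge0 ler_root4 // max_entryP.
Qed.

(** Going backwards around the circle reaches every index. *)
Lemma ord_pred_closed n (P : pred 'I_n.+1) :
  (forall i, P i -> P (ord_pred i)) -> forall i, P i -> forall j, P j.
Proof.
move=> step i Pi.
have val_pred (j : 'I_n.+1) : (0 < j)%N -> ord_pred j = j.-1 :> nat.
  case: j => -[|j] //= jn _.
  by rewrite /= modnDr modn_small // ltnW.
have down d (j : 'I_n.+1) : P j -> forall k : 'I_n.+1, (k + d)%N = j -> P k.
  elim: d j => [|d IH] j Pj k kdj.
    by suff -> : k = j by []; apply: val_inj; rewrite /= -kdj addn0.
  apply: (IH (ord_pred j)); first exact: step.
  by rewrite val_pred -kdj addnS.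
have P0 : P ord0 by apply: (down i i Pi ord0).
have Pmax : P ord_max.
  suff -> : ord_max = ord_pred (ord0 : 'I_n.+1) by apply: step.
  by apply: val_inj => /=; rewrite modn_small.
by move=> j; apply: (down (n - j)%N _ Pmax); rewrite subnKC // -ltnS.
Qed.

Definition cyc_weight z n (m : n.+1.-tuple nat) : R :=
  \prod_(i < n.+1) (z ^+ tnth m i - (tnth m i < tnth m (ord_pred i))%N%:R).

Lemma subr_expr_le z a : 0 <= z <= 1 -> 1 - z ^+ a <= a%:R * (1 - z).
Proof.
move=> /andP[z0 z1]; elim: a => [|a IH]; first by rewrite expr0 subrr mul0r.
rewrite exprS -natr1.
have h1 : 0 <= z ^+ a by rewrite exprn_ge0.
have h2 : z ^+ a <= 1 by rewrite exprn_ile1.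
nra.
Qed.

Lemma expr_decay z a : 0 <= z <= 1 -> a%:R * z ^+ a * (1 - z) <= 1.
Proof.
move=> /andP[z0 z1].
suff : a%:R * z ^+ a * (1 - z) <= 1 - z ^+ a.
  by move=> /le_trans; apply; rewrite gerBl exprn_ge0.
elim: a => [|a IH]; first by rewrite expr0 subrr !mul0r.
rewrite exprS -natr1.
have h1 : 0 <= z ^+ a by rewrite exprn_ge0.
have h2 : z ^+ a <= 1 by rewrite exprn_ile1.
have h3 := ler_wpM2l z0 IH.
have h4 : 0 <= (1 - z) * (1 - z * z ^+ a).
  by rewrite mulr_ge0 ?subr_ge0 // mulr_ile1.
have -> : (a%:R + 1) * (z * z ^+ a) * (1 - z) =
  z * (a%:R * z ^+ a * (1 - z)) + z * z ^+ a * (1 - z) by ring.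
nra.
Qed.

(** A largest entry following a smaller one contributes [z ^+ M], a smallest
    entry following a larger one contributes [1 - z ^+ a]; no other factor
    exceeds 1, and [z ^+ M * (1 - z ^+ a) <= a * M * z ^+ M * (1 - z) / M]. *)
Lemma cyc_weight_bound z n (m : n.+1.-tuple nat) p d :
  0 <= z <= 1 -> (0 < tnth m d)%N ->
  (forall i, tnth m d <= tnth m i <= tnth m p)%N ->
  `|cyc_weight z m| <= (tnth m d)%:R / (tnth m p)%:R.
Proof.
move=> z01 md0 mdp; have /andP[z0 z1] := z01.
set f := fun i => z ^+ tnth m i - (tnth m i < tnth m (ord_pred i))%N%:R.
have zX a : 0 <= z ^+ a <= 1 by rewrite exprn_ge0 ?exprn_ile1.
have f1 i : `|f i| <= 1.
  have /andP[h0 h1] := zX (tnth m i).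
  by rewrite /f ler_norml; case: (_ < _)%N => /=; lra.
have prod1 (P : pred 'I_n.+1) : \prod_(i < n.+1 | P i) `|f i| <= 1.
  by rewrite prodr_ile1 // => i _; rewrite normr_ge0 f1.
have mp0 : (0 < tnth m p)%N by case/andP: (mdp p) => /(leq_trans md0).
rewrite /cyc_weight normr_prod.
have [E|ne] := eqVneq (tnth m d) (tnth m p).
  by rewrite E divff ?prod1 // pnatr_eq0 -lt0n.
have [i /eqP mi lti] : exists2 i, tnth m i == tnth m p &
    tnth m (ord_pred i) != tnth m p.
  apply/exists_inP; apply: contraNT ne => /exists_inPn h.
  apply/eqP/eqP.
  apply: (@ord_pred_closed _ (fun i => tnth m i == tnth m p) _ p _ d) => //.
  by move=> i /h; rewrite negbK.
have [j /eqP mj ltj] : exists2 j, tnth m j == tnth m d &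
    tnth m (ord_pred j) != tnth m d.
  apply/exists_inP; apply: contraNT ne => /exists_inPn h.
  rewrite eq_sym.
  apply: (@ord_pred_closed _ (fun i => tnth m i == tnth m d) _ d _ p) => //.
  by move=> j /h; rewrite negbK.
have ji : j != i by apply: contraNneq ne => ji; rewrite -mi -mj ji.
rewrite (bigD1 i) //= (bigD1 j) //= -/(f i) -/(f j).
have -> : f i = z ^+ tnth m p.
  by rewrite /f mi ltnNge; have /andP[_ ->] := mdp (ord_pred i); rewrite subr0.
have -> : f j = - (1 - z ^+ tnth m d).
  rewrite /f mj ltn_neqAle eq_sym ltj; have /andP[-> _] := mdp (ord_pred j).
  by rewrite opprB.
rewrite normrN !ger0_norm ?subr_ge0;
  try by case/andP: (zX (tnth m d)); case/andP: (zX (tnth m p)).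
set M := tnth m p; set a := tnth m d.
have /andP[M0 M1] := zX M; have /andP[a0 a1] := zX a.
have hp := prod1 (fun k => (k != i) && (k != j)).
apply: (@le_trans _ _ (z ^+ M * (1 - z ^+ a))).
  by rewrite ler_wpM2l // ler_piMr // subr_ge0.
have Mr : 0 < M%:R :> R by rewrite ltr0n.
rewrite ler_pdivlMr //.
have h1 := subr_expr_le a z01; have h2 := expr_decay M z01.
have h3 : z ^+ M * (1 - z ^+ a) <= z ^+ M * (a%:R * (1 - z)) by rewrite ler_wpM2l.
have h4 := ler_wpM2r (ltW Mr) h3.
apply: (le_trans h4).
have -> : z ^+ M * (a%:R * (1 - z)) * M%:R = a%:R * (M%:R * z ^+ M * (1 - z)) by ring.
by rewrite ler_piMr.
Qed.

(** A sequence tending to 1 from below, along which Abel limits are taken. *)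
Definition abel (N : nat) : R := 1 - N.+1%:R^-1.

Lemma abel_ge0_le1 N : 0 <= abel N <= 1.
Proof.
rewrite /abel subr_ge0 gerBl invr_ge0 ler0n andbT.
by rewrite invf_le1 ?ltr0n // ler1n.
Qed.

Lemma abel_lt1 N : abel N < 1.
Proof. by rewrite /abel gtrBl invr_gt0 ltr0n. Qed.

Lemma abel_expr_cvg a : (fun N => abel N ^+ a) @ \oo --> (1 : R).
Proof.
have h : abel @ \oo --> (1 : R).
  rewrite -[X in _ --> X](subr0 (1 : R)); apply: cvgB; first exact: cvg_cst.
  exact: cvg_harmonic.
rewrite -[X in _ --> X](expr1n R a).
exact: (cvg_comp _ _ h (@exprn_continuous R a 1)).
Qed.

(** The limit factor at [i] is 0 if entry [i] is smaller than its predecessor and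
    1 otherwise. If it is never smaller, then, starting from a least entry and
    going backwards, all entries are equal. *)
Lemma cyc_weight_cvg n (m : n.+1.-tuple nat) :
  (fun N => cyc_weight (abel N) m) @ \oo -->
  ([forall i, tnth m i == tnth m ord0]%:R : R).
Proof.
have -> : [forall i, tnth m i == tnth m ord0]%:R =
    \prod_(i < n.+1) (1 - (tnth m i < tnth m (ord_pred i))%N%:R) :> R.
  have [/forallP eqm|] := boolP [forall i, tnth m i == tnth m ord0].
    rewrite big1 // => i _.
    by rewrite (eqP (eqm i)) (eqP (eqm (ord_pred i))) ltnn subr0.
  move=> ne; have /existsP[i lt] : [exists i, tnth m i < tnth m (ord_pred i)]%N.
    apply: contraNT ne; rewrite negb_exists => /forallP le.
    set d := [arg min_(i < ord0) tnth m i]%N.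
    have dmin j : (tnth m d <= tnth m j)%N.
      by rewrite /d; case: arg_minnP => // i _; apply.
    have eqd := @ord_pred_closed _ (fun i => tnth m i == tnth m d) _ d (eqxx _).
    apply/forallP => i; rewrite (eqP (eqd _ i)) ?(eqP (eqd _ ord0)) // => j /eqP E;
      by have := le j; rewrite -leqNgt eqn_leq dmin andbT E.
  by rewrite (bigD1 i) //= lt subrr mul0r.
rewrite /cyc_weight; elim: (index_enum _) => [|i r IH].
  by rewrite big_nil; under eq_fun do rewrite big_nil; exact: cvg_cst.
rewrite big_cons; under eq_fun do rewrite big_cons.
apply: cvgM => //; apply: cvgB; [exact: abel_expr_cvg|exact: cvg_cst].
Qed.

End Domination.

(** * From decreasing indices to gaps *)

Section Gaps.
Context {r : nat}.

Definition positive_tuples : set (r.-tuple nat) := [set m | forall i, 0 < tnth m i]%N.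

Definition add_entry (i j : 'I_r) (n : r.-tuple nat) : r.-tuple nat :=
  [tuple (if k == i then tnth n i + tnth n j else tnth n k)%N | k < r].

Lemma tnth_add_entry i j n k :
  tnth (add_entry i j n) k = (if k == i then tnth n i + tnth n j else tnth n k)%N.
Proof. exact: tnth_mktuple. Qed.

Fixpoint partial_sums (L : seq ('I_r * 'I_r)) n : r.-tuple nat :=
  if L is p :: L' then add_entry p.1 p.2 (partial_sums L' n) else n.

Definition descending (L : seq ('I_r * 'I_r)) (m : r.-tuple nat) : bool :=
  all (fun p => tnth m p.2 < tnth m p.1)%N L.

(** The head pair alters entry [p.1] last, so that index must not occur in the
    constraints of the tail. *)
Fixpoint chained (L : seq ('I_r * 'I_r)) : bool :=
  if L is p :: L' then
    [&& p.2 != p.1, all (fun q => (q.1 != p.1) && (q.2 != p.1)) L' & chained L']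
  else true.

(** Each pair of indices [(i, j)] adds the constraint that entry [i] exceeds
    entry [j], and is absorbed by taking their difference as new variable. *)
Lemma partial_sums_bij L : chained L ->
  set_bij positive_tuples (positive_tuples `&` [set m | descending L m])
    (partial_sums L).
Proof.
elim: L => [_|[i j] L IH] /=.
  by split=> // m [mpos _]; exists m.
move=> /and3P[/= ji iL /IH {}IH].
have desc_add n : descending L (add_entry i j n) = descending L n.
  apply: eq_in_all => q /(allP iL) /andP[/= q1 q2].
  by rewrite !tnth_add_entry (negPf q1) (negPf q2).
apply: (set_bij_comp IH); split.
- move=> n [npos nL]; split=> [k|] /=.
    by rewrite tnth_add_entry; case: eqP => // _; rewrite addn_gt0 npos.
  rewrite desc_add nL andbT !tnth_add_entry eqxx (negPf ji).
  by rewrite -[ltnLHS]add0n ltn_add2r npos.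
- move=> n n' _ _ E.
  have En k : k != i -> tnth n k = tnth n' k.
    move=> ki; have := congr1 (fun t => tnth t k) E.
    by rewrite !tnth_add_entry (negPf ki).
  apply: eq_from_tnth => k; have [->|/En//] := eqVneq k i.
  have := congr1 (fun t => tnth t i) E.
  by rewrite !tnth_add_entry eqxx (En j ji) => /addIn.
- move=> m [mpos /= /andP[lt mL]].
  pose n := [tuple (if k == i then tnth m i - tnth m j else tnth m k)%N | k < r].
  have E : add_entry i j n = m.
    apply: eq_from_tnth => k; rewrite tnth_add_entry !tnth_mktuple eqxx (negPf ji).
    by case: eqP => [->|//]; rewrite subnK // ltnW.
  exists n => //; split; last by rewrite /= -desc_add E.
  move=> k; rewrite tnth_mktuple; case: eqP => // _.
  by rewrite subn_gt0.
Qed.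

Lemma permute_entries_bij (s : 'I_r -> 'I_r) : injective s ->
  set_bij positive_tuples positive_tuples
    (fun n => [tuple tnth n (s i) | i < r]).
Proof.
move=> s_inj; have [t sK tK] := injF_bij s_inj; split.
- by move=> n npos i; rewrite tnth_mktuple.
- move=> n n' _ _ E; apply: eq_from_tnth => i.
  by have := congr1 (fun u => tnth u (t i)) E; rewrite !tnth_mktuple tK.
- move=> m mpos; exists [tuple tnth m (t i) | i < r].
    by move=> i; rewrite tnth_mktuple.
  by apply: eq_from_tnth => i; rewrite !tnth_mktuple sK.
Qed.

End Gaps.

(** * Coefficients as sums over compositions of the weight *)

Section Coefficients.
Context {F : fieldType}.

Definition composition r l (f : {ffun 'I_r -> 'I_l.+1}) : bool :=
  [forall i, 0 < f i]%N && (\sum_i f i == l)%N.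

(** Multiplying each factor by ['X] shifts the exponents so that they run over the
    compositions of [k + r] into [r] positive parts. *)
Lemma coef_prod_geom r k (a x : 'I_r -> F) :
  (\prod_(i < r) geom k (a i) (x i))`_k =
  \sum_(f : {ffun 'I_r -> 'I_(k + r).+1} | composition f)
    \prod_(i < r) (x i ^+ (f i).-1 / a i ^+ f i).
Proof.
have -> : (\prod_(i < r) geom k (a i) (x i))`_k =
    (\prod_(i < r) (geom k (a i) (x i) * 'X))`_(k + r).
  by rewrite big_split /= prodr_const card_ord coefMXn ltnNge leq_addl addnK.
have expand i : geom k (a i) (x i) * 'X =
    \sum_(j < (k + r).+1) (geom k (a i) (x i) * 'X)`_j *: 'X^j.
  rewrite -poly_def; apply/polyP => j; rewrite coef_poly; case: ltnP => // lej.
  rewrite coefMX coef_geom; case: j lej => //= j lej.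
  rewrite leqNgt (_ : k < j)%N ?mul0r //.
  by have := leq_ltn_trans (leq0n i) (ltn_ord i); lia.
under eq_bigr do rewrite expand.
rewrite bigA_distr_bigA /= coef_sum [RHS]big_mkcond /=; apply: eq_bigr => f _.
under eq_bigr do rewrite -mul_polyC.
rewrite big_split /= prodrXr -rmorph_prod coefCM coefXn.
rewrite /composition [_ == (_ + _)%N]eq_sym.
case: eqP => [sf|_]; last by rewrite mulr0 andbF.
rewrite mulr1 andbT.
have [/forallP fpos|] := boolP [forall i, 0 < f i]%N; last first.
  rewrite negb_forall => /existsP[i]; rewrite -eqn0Ngt => /eqP fi0.
  by rewrite (bigD1 i) //= coefMX fi0 mul0r.
apply: eq_bigr => i _; rewrite coefMX gtn_eqF // coef_geom prednK // mulr_natl.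
suff -> : ((f i).-1 <= k)%N by [].
have le : (\sum_(j < r | j != i) 1 <= \sum_(j < r | j != i) f j)%N.
  by apply: leq_sum => j _; exact: fpos.
have card : (\sum_(j < r | j != i) 1 = r.-1)%N.
  by rewrite sum1_card cardC1 card_ord.
move: sf le; rewrite card (bigD1 i) //=; set S := (\sum_(_ < _ | _) _)%N.
by have := fpos i; have := leq_ltn_trans (leq0n i) (ltn_ord i); lia.
Qed.

End Coefficients.

(** * Multiple polylogarithms and their Abel limits *)

Section Polylog.
Context {R : realType}.
Implicit Types (z : R).

Lemma mzv_index_positive r (m : r.-tuple nat) : mzv_index m -> positive_tuples m.
Proof. by move=> [_ /all_tnthP]. Qed.

Lemma max_entry_head r (m : r.+1.-tuple nat) :
  mzv_index m -> max_entry m = tnth m ord0.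
Proof.
move=> [ms _]; apply/eqP; rewrite eqn_leq max_entryP andbT.
apply/bigmax_leqP => i _.
have geqm : sorted geq m by apply: sub_sorted ms => a b /ltnW.
have geq_trans : transitive geq by move=> a b c /= ba /leq_trans; apply.
rewrite !(tnth_nth 0%N).
have := sorted_leq_nth geq_trans leqnn 0%N geqm.
by move=> /(_ 0%N i); apply; rewrite ?inE ?size_tuple.
Qed.

Lemma mzv_term_ge0 r (s m : r.-tuple nat) : 0 <= mzv_term R s m.
Proof. by rewrite prodr_ge0 // => i _; rewrite invr_ge0 exprn_ge0. Qed.

Lemma mzv_term_le r (s m : r.-tuple nat) (e : 'I_r -> nat) :
  (forall i, e i <= tnth s i)%N -> positive_tuples m ->
  mzv_term R s m <= (\prod_(i < r) (tnth m i)%:R ^+ e i)^-1.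
Proof.
move=> es mpos; rewrite -prodfV; apply: ler_prod => i _.
have m0 : 0 < (tnth m i)%:R :> R by rewrite ltr0n mpos.
rewrite invr_ge0 exprn_ge0 ?ler0n //= lef_pV2 ?posrE ?exprn_gt0 //.
by rewrite ler_weXn2l // ler1n mpos.
Qed.

(** Only the largest index carries a power of [z]: this makes the series converge
    when the first exponent is 1 and, since the largest index is the sum of all
    gaps, the power is multiplicative and symmetric in the gaps. *)
Definition polylog r z (s : r.+1.-tuple nat) : R :=
  fine (\esum_(m in @mzv_index r.+1) (z ^+ tnth m ord0 * mzv_term R s m)%:E).

Lemma hsum_esum (T : choiceType) (A : set T) (f : T -> R) s :
  hsum A f s -> s = fine (\esum_(x in A) (f x)%:E).
Proof. by move=> [_ ->]. Qed.

Lemma hsum_dominated_index (f : 4.-tuple nat -> R) C :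
  0 <= C -> (forall m, mzv_index m -> 0 <= f m <= C * dominant m) ->
  hsum (@mzv_index 4) f (fine (\esum_(m in @mzv_index 4) (f m)%:E)).
Proof.
move=> C0 fC; have [d hd] := @hsum_dominant R.
have [t ht _] := hsum_subset (@subsetT _ (@mzv_index 4)) hd.
have [s hs _] := hsum_dom fC (hsumZ C0 ht).
by have <- := hsum_esum hs.
Qed.

(** The factor [z ^ m_0] is at most a constant over [m_0], the largest index. *)
Lemma hsum_polylog z (s : 4.-tuple nat) : 0 <= z < 1 ->
  (forall i, 0 < tnth s i)%N ->
  hsum (@mzv_index 4) (fun m => z ^+ tnth m ord0 * mzv_term R s m) (polylog z s).
Proof.
move=> /andP[z0 z1] s0.
have z1' : 0 < 1 - z by rewrite subr_gt0.
apply: (@hsum_dominated_index _ (1 - z)^-1); first by rewrite invr_ge0 ltW.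
move=> m mi; have mpos := mzv_index_positive mi.
rewrite mulr_ge0 ?exprn_ge0 ?mzv_term_ge0 //=.
have := mzv_term_le (e := fun=> 1%N) s0 mpos; rewrite /dominant.
set P := \prod_(i < 4) _ => le.
rewrite invfM mulrA ler_pM ?exprn_ge0 ?mzv_term_ge0 //.
rewrite (max_entry_head mi) -invfM.
have M0 : 0 < (tnth m ord0)%:R :> R by rewrite ltr0n mpos.
rewrite -[leRHS]mul1r ler_pdivlMr ?mulr_gt0 //.
rewrite (_ : _ * _ = (tnth m ord0)%:R * z ^+ tnth m ord0 * (1 - z)); last by ring.
by apply: expr_decay; rewrite z0 ltW.
Qed.

(** An exponent at least 2 on the largest index is what the dominating family
    requires. *)
Lemma polylog_cvg (s : 4.-tuple nat) :
  (forall i, 0 < tnth s i)%N -> (1 < tnth s ord0)%N ->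
  (fun N => polylog (abel N) s) @ \oo --> mzv R s.
Proof.
move=> s0 s1; have [d hd] := @hsum_dominant R.
have [t ht _] := hsum_subset (@subsetT _ (@mzv_index 4)) hd.
have le m : mzv_index m -> mzv_term R s m <= dominant m.
  move=> mi; have mpos := mzv_index_positive mi.
  have := mzv_term_le (e := fun i => (i == ord0).+1) _ mpos; move=> /(_ s) /=.
  rewrite /dominant (max_entry_head mi) !big_ord_recl !big_ord0 /=.
  rewrite !expr1 expr2 -!mulrA; apply.
  by move=> i; case: eqP => [->|_]; [exact: s1|exact: s0].
have [|||v hv] := @hsum_dominated R _ (@mzv_index 4)
   (fun N m => abel N ^+ tnth m ord0 * mzv_term R s m) (mzv_term R s)
   (@dominant R 4) (fun N => polylog (abel N) s) t _ _ ht _.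
- move=> m _; rewrite -[X in _ --> X]mul1r; apply: cvgM; last exact: cvg_cst.
  exact: abel_expr_cvg.
- move=> N m mi; have /andP[z0 z1] := @abel_ge0_le1 R N.
  rewrite mulr_ge0 ?exprn_ge0 ?mzv_term_ge0 //=.
  by apply: le_trans (le m mi); rewrite ler_piMl ?mzv_term_ge0 // exprn_ile1.
- move=> N; apply: hsum_polylog => //; have /andP[-> _] := @abel_ge0_le1 R N.
  exact: abel_lt1.
by rewrite (hsum_esum hv).
Qed.

End Polylog.

(** * Words in the four positions of the circle *)

Definition exponents r l (f : {ffun 'I_r -> 'I_l.+1}) : r.-tuple nat :=
  [tuple (f i : nat) | i < r].

Lemma composition_gt0 r l (f : {ffun 'I_r -> 'I_l.+1}) i :
  composition f -> (0 < tnth (exponents f) i)%N.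
Proof. by move=> /andP[/forallP fpos _]; rewrite tnth_mktuple. Qed.

Definition nonneg_ints (v : seq int) : bool := all (fun a => 0 <= a) v.

Fixpoint suffix_sums (v : seq int) : seq int :=
  if v is _ :: v' then foldr +%R 0 v :: suffix_sums v' else [::].

Definition args (w : seq ('I_4 * int)) : seq int := suffix_sums (unzip2 w).

Definition o0 : 'I_4 := @Ordinal 4 0 isT.
Definition o1 : 'I_4 := @Ordinal 4 1 isT.
Definition o2 : 'I_4 := @Ordinal 4 2 isT.
Definition o3 : 'I_4 := @Ordinal 4 3 isT.

Lemma ord4P (P : 'I_4 -> Prop) : P o0 -> P o1 -> P o2 -> P o3 -> forall i, P i.
Proof.
move=> P0 P1 P2 P3 [[|[|[|[|//]]]] lt];
  by rewrite (bool_irrelevance lt isT).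
Qed.

Lemma big_ord4 (T : Type) (idx : T) (op : Monoid.law idx) (F : 'I_4 -> T) :
  \big[op/idx]_(i < 4) F i = op (F o0) (op (F o1) (op (F o2) (F o3))).
Proof.
rewrite !big_ord_recl big_ord0 Monoid.mulm1.
by congr (op _ (op _ (op _ _))); congr F; apply: val_inj.
Qed.

Section Words.
Context {R : realType} (k : nat).
Local Notation l := (k + 4)%N.
Local Notation A := {poly %/ ('X^(k.+1) : {poly R})}.

(** The coefficient of [t ^ k] in the sum over [m_0 > ... > m_3] of
    [z ^ m_0 / ((m_0 - v_0 * t) ... (m_3 - v_3 * t))]. *)
Definition mpl z (v : seq int) : R :=
  \sum_(f : {ffun 'I_4 -> 'I_l.+1} | composition f)
    (\prod_(i < 4) (v`_i)%:~R ^+ (f i).-1) * polylog z (exponents f).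

Lemma prod_nonneg (v : seq int) (f : {ffun 'I_4 -> 'I_l.+1}) :
  nonneg_ints v -> 0 <= \prod_(i < 4) (v`_i)%:~R ^+ (f i).-1 :> R.
Proof.
move=> v0; rewrite prodr_ge0 // => i _; rewrite exprn_ge0 // ler0z.
by have [/(all_nthP 0 v0)//|le] := ltnP i (size v); rewrite nth_default.
Qed.

Lemma coef_prod_geom_mzv (v : seq int) (m : 4.-tuple nat) :
  (\prod_(i < 4) geom k (tnth m i)%:R (v`_i)%:~R)`_k =
  \sum_(f : {ffun 'I_4 -> 'I_l.+1} | composition f)
    (\prod_(i < 4) (v`_i)%:~R ^+ (f i).-1) * mzv_term R (exponents f) m.
Proof.
rewrite coef_prod_geom; apply: eq_bigr => f _; rewrite big_split /=.
by congr (_ * _); apply: eq_bigr => i _; rewrite tnth_mktuple.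
Qed.

Lemma hsum_mpl z (v : seq int) : 0 <= z < 1 -> nonneg_ints v ->
  hsum (@mzv_index 4)
    (fun m => z ^+ tnth m ord0 *
       (\prod_(i < 4) geom k (tnth m i)%:R (v`_i)%:~R)`_k) (mpl z v).
Proof.
move=> z01 v0; rewrite /mpl -big_filter.
apply: (hsum_ext (f := fun m => \sum_(f <- [seq f <- index_enum _ | composition f])
   ((\prod_(i < 4) (v`_i)%:~R ^+ (f i).-1) *
     (z ^+ tnth m ord0 * mzv_term R (exponents f) m)))).
  move=> m _; rewrite coef_prod_geom_mzv mulr_sumr big_filter.
  by apply: eq_bigr => f _; rewrite mulrCA.
apply: hsum_sum => f; rewrite mem_filter => /andP[fc _].
apply: hsumZ; first exact: prod_nonneg.
by apply: hsum_polylog => // i; exact: composition_gt0.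
Qed.

(** The pair [(a, y)] stands for [a - y * 'X], so addition of pairs is addition of
    denominators. *)
Definition inv_geom (p : nat * int) : A :=
  in_qpoly 'X^(k.+1) (geom k p.1%:R p.2%:~R).

Lemma inv_geomM (p q : nat * int) : (0 < p.1)%N -> (0 < q.1)%N ->
  inv_geom p * inv_geom q = inv_geom (p + q) * (inv_geom p + inv_geom q).
Proof.
case: p q => [a x] [b y] /= a0 b0; rewrite /inv_geom /=.
have nz c : (0 < c)%N -> c%:R != 0 :> R by rewrite pnatr_eq0 -lt0n.
have := geomK k x%:~R (nz _ a0); have := geomK k y%:~R (nz _ b0).
have ab : (0 < a + b)%N by rewrite addn_gt0 a0.
have := geomK k (x + y)%:~R (nz _ ab).
have -> : (a + b)%:R%:P - (x + y)%:~R *: 'X =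
  (a%:R%:P - x%:~R *: 'X) + (b%:R%:P - y%:~R *: 'X) :> {poly R}.
  by rewrite natrD polyCD intrD scalerDl opprD addrACA.
rewrite rmorphD.
set P := in_qpoly _ (_ - x%:~R *: _); set Q := in_qpoly _ (_ - y%:~R *: _).
set u := in_qpoly _ (geom k a%:R _); set v := in_qpoly _ (geom k b%:R _).
set w := in_qpoly _ (geom k _ (x + y)%:~R) => hw hv hu.
transitivity (((P + Q) * w) * (u * v)); first by rewrite hw mul1r.
transitivity (w * (u * (Q * v) + (P * u) * v)); last by rewrite hv hu mulr1 mul1r.
by ring.
Qed.

Definition letter (n : 4.-tuple nat) (a : 'I_4 * int) : nat * int :=
  (tnth n a.1, a.2).

Definition word_term n (w : seq ('I_4 * int)) : A :=
  suffix_prod inv_geom [seq letter n a | a <- w].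

(** Letters with suffix sums [x`_i]: on an arc the denominator at index [i] is to
    be [m_i - x_i * 'X], and [m_i] is a suffix sum of gaps. *)
Fixpoint spell (x : seq int) (w : seq 'I_4) : seq ('I_4 * int) :=
  if w is i :: w' then
    (i, x`_i - (if w' is j :: _ then x`_j else 0)) :: spell x w'
  else [::].

Fixpoint links (w : seq 'I_4) : seq ('I_4 * 'I_4) :=
  if w is i :: w' then
    (if w' is j :: _ then [:: (i, j)] else [::]) ++ links w' else [::].

Definition chain (ys : seq int) (n : 4.-tuple nat) : A :=
  suffix_prod inv_geom (zip n ys).

Lemma mzv_index4E :
  @mzv_index 4 = positive_tuples `&`
    [set m | descending [:: (o0, o1); (o1, o2); (o2, o3)] m].
Proof.
apply/seteqP; split=> m; case/tupleP: m => a m; case/tupleP: m => b m;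
  case/tupleP: m => c m; case/tupleP: m => d m; rewrite (tuple0 m);
  rewrite /mzv_index /positive_tuples /descending /= !(tnth_nth 0%N) /=.
- move=> [/and4P[ba cb dc _] /and5P[a0 b0 c0 d0 _]]; split; last by rewrite ba cb dc.
  by apply: ord4P; rewrite (tnth_nth 0%N).
- move=> [mpos /and4P[ba cb dc _]]; split; first by rewrite ba cb dc.
  have := (mpos o0, mpos o1, mpos o2, mpos o3); rewrite !(tnth_nth 0%N) /=.
  by move=> [[[-> ->] ->] ->].
Qed.

(** The substitution of partial sums for the indices is the case of a single
    arc. *)
Lemma hsum_chain z (ys : seq int) : 0 <= z < 1 -> size ys = 4 ->
  nonneg_ints (suffix_sums ys) ->
  hsum positive_tuples
    (fun n => z ^+ (\sum_(i < 4) tnth n i) * (chain ys n : {poly R})`_k)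
    (mpl z (suffix_sums ys)).
Proof.
move=> z01 sys nn; have := hsum_mpl z01 nn.
rewrite mzv_index4E.
have bij := partial_sums_bij (L := [:: (o0, o1); (o1, o2); (o2, o3)]) isT.
rewrite (hsum_reindex _ _ bij).
apply: hsum_ext => n npos /=; rewrite !big_ord4 !tnth_add_entry /=.
case: ys sys nn => [//|y0 [//|y1 [//|y2 [//|y3 [|//]]]]] _ _.
congr (_ * _); rewrite -coef_inq; congr (polyseq (polyn _))`_k.
rewrite !rmorphM /=.
case/tupleP: n {npos} => a n; case/tupleP: n => b n.
case/tupleP: n => c n; case/tupleP: n => d n; rewrite (tuple0 n).
rewrite /chain /= !(tnth_nth 0%N) /= !big_cons !big_nil mulr1.
by rewrite /inv_geom /= !addr0.
Qed.

End Words.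

Lemma mktuple4 (T : Type) (F : 'I_4 -> T) :
  [tuple F i | i < 4] = [tuple F o0; F o1; F o2; F o3].
Proof. by apply: eq_from_tnth; apply: ord4P; rewrite tnth_mktuple. Qed.

Definition words_of_arcs (x : seq int) (ws : seq (seq 'I_4)) :=
  shuffles [seq spell x w | w <- ws].

Definition arc_links (ws : seq (seq 'I_4)) := flatten [seq links w | w <- ws].

Section Arcs.
Context {R : realType} (k : nat).

(** The sum over the gaps does not see which gap belongs to which letter, so a
    word contributes only through the suffix sums of its parameters. *)
Lemma hsum_word z (w : seq ('I_4 * int)) : 0 <= z < 1 ->
  perm_eq (unzip1 w) (enum 'I_4) -> nonneg_ints (args w) ->
  hsum positive_tuples
    (fun n => z ^+ (\sum_(i < 4) tnth n i) * (word_term k n w : {poly R})`_k)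
    (mpl k z (args w)).
Proof.
move=> z01 pw nn.
have sw : size w = 4 by rewrite -(size_map fst) (perm_size pw) size_enum_ord.
pose s (i : 'I_4) := nth o0 (unzip1 w) i.
have s_inj : injective s.
  move=> i j /eqP; rewrite nth_uniq ?size_map ?sw // => [/eqP/val_inj //|].
  by rewrite (perm_uniq pw) enum_uniq.
have sys : size (unzip2 w) = 4 by rewrite size_map.
have := hsum_chain k z01 sys nn.
rewrite (hsum_reindex _ _ (permute_entries_bij s_inj)).
apply: hsum_ext => n _ /=; congr (_ * _).
  rewrite [in RHS](reindex_inj s_inj) /=; congr (z ^+ _).
  by apply: eq_bigr => i _; rewrite tnth_mktuple.
congr (polyseq (polyn _))`_k; rewrite /chain /word_term; congr suffix_prod.
rewrite mktuple4 /s.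
by case: w sw {nn pw sys s s_inj} => [|[? ?] [|[? ?] [|[? ?] [|[? ?] []]]]].
Qed.

(** For arcs that partition the indices: partial sums along each arc turn the
    sum over descending entries into a sum over unrestricted gaps, in which
    the product over the arcs splits into its shuffles. *)
Lemma hsum_arcs z (x : seq int) (ws : seq (seq 'I_4)) : 0 <= z < 1 ->
  chained (arc_links ws) ->
  perm_eq (flatten ws) (enum 'I_4) ->
  (forall n, \sum_(w <- ws) tnth (partial_sums (arc_links ws) n) (head o0 w) =
    \sum_(i < 4) tnth n i)%N ->
  (forall (A : comNzRingType) (g : nat * int -> A) n,
    \prod_(i < 4) g (tnth (partial_sums (arc_links ws) n) i, x`_i) =
    \prod_(w <- ws) suffix_prod g [seq letter n a | a <- spell x w]) ->
  all (fun w => nonneg_ints (args w)) (words_of_arcs x ws) ->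
  hsum positive_tuples
    (fun m => (descending (arc_links ws) m)%:R *
       (z ^+ (\sum_(w <- ws) tnth m (head o0 w)) *
         (\prod_(i < 4) geom k (tnth m i)%:R ((x`_i)%:~R : R))`_k))
    (\sum_(w <- words_of_arcs x ws) mpl k z (args w)).
Proof.
move=> z01 chained_ws ws_perm heads prod_ws /allP nn.
apply: (hsum_ext (f := fun m => (m \in [set m | descending (arc_links ws) m])%:R *
       (z ^+ (\sum_(w <- ws) tnth m (head o0 w)) *
         (\prod_(i < 4) geom k (tnth m i)%:R ((x`_i)%:~R : R))`_k))).
  by move=> m _; rewrite mem_setE.
apply/hsum_restrict/(hsum_reindex _ _ (partial_sums_bij chained_ws)).
have perm_word w : w \in words_of_arcs x ws -> perm_eq (unzip1 w) (enum 'I_4).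
  move=> /shuffles_perm /(perm_map fst) /perm_trans; apply.
  rewrite map_flatten -map_comp (eq_map (g := id)) ?map_id // => u /=.
  by elim: u => //= i u ->.
apply: (hsum_ext (f := fun n => \sum_(w <- words_of_arcs x ws)
   (z ^+ (\sum_(i < 4) tnth n i) * (word_term k n w : {poly R})`_k))); last first.
  by apply: hsum_sum => w win; apply: hsum_word; [|exact: perm_word|exact: nn].
move=> n npos /=; rewrite heads -mulr_sumr; congr (_ * _).
rewrite -coef_sum -(poly_of_qpoly_sum _ _ (fun w => word_term k n w)) -[RHS]coef_inq.
congr (polyseq (polyn _))`_k; rewrite rmorph_prod /=.
rewrite (prod_ws _ (@inv_geom R k)).
have -> : \prod_(w <- ws) suffix_prod (inv_geom k) [seq letter n a | a <- spell x w] =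
  \prod_(w <- [seq [seq letter n a | a <- spell x w] | w <- ws])
    suffix_prod (@inv_geom R k) w by rewrite big_map.
rewrite (@prod_suffix_prod _ _ _ (fun p => 0 < p.1)%N).
- by rewrite /words_of_arcs (map_comp (map (letter n))) map_shuffles big_map.
- by move=> [a ?] [b ?] /= a0 b0; rewrite addn_gt0 a0.
- exact: inv_geomM.
- move=> p /flattenP[u /mapP[w _ ->] /mapP[a _ ->]] /=; exact: npos.
Qed.

End Arcs.

(** * The cyclic sum formula *)

(** The ways to cut the circle into arcs, according to the parity of the number of
    uncut edges, which is the number of minus signs in the expansion. *)
Definition even_circle : seq (seq (seq 'I_4)) :=
  [:: [:: [:: o0]; [:: o1]; [:: o2]; [:: o3]];
      [:: [:: o0; o1; o2]; [:: o3]]; [:: [:: o1; o2; o3]; [:: o0]];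
      [:: [:: o2; o3; o0]; [:: o1]]; [:: [:: o3; o0; o1]; [:: o2]];
      [:: [:: o0; o1]; [:: o2; o3]]; [:: [:: o1; o2]; [:: o3; o0]]].

Definition odd_circle : seq (seq (seq 'I_4)) :=
  [:: [:: [:: o0; o1]; [:: o2]; [:: o3]]; [:: [:: o1; o2]; [:: o3]; [:: o0]];
      [:: [:: o2; o3]; [:: o0]; [:: o1]]; [:: [:: o3; o0]; [:: o1]; [:: o2]];
      [:: [:: o0; o1; o2; o3]]; [:: [:: o1; o2; o3; o0]];
      [:: [:: o2; o3; o0; o1]]; [:: [:: o3; o0; o1; o2]]].

Lemma all_seqP (T : eqType) (P : T -> Prop) (a : T) (s : seq T) :
  P a -> (forall b, b \in s -> P b) -> forall b, b \in a :: s -> P b.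
Proof. by move=> Pa Ps b; rewrite inE => /orP[/eqP ->|/Ps]. Qed.

Lemma circle_links : {in even_circle ++ odd_circle, forall ws,
  chained (arc_links ws) /\ perm_eq (flatten ws) (enum 'I_4)}.
Proof.
have -> : enum 'I_4 = [:: o0; o1; o2; o3].
  by apply: (inj_map val_inj); rewrite val_enum_ord.
by do 15! [apply: all_seqP; first by []].
Qed.

Lemma circle_heads (n : 4.-tuple nat) : {in even_circle ++ odd_circle, forall ws,
  \sum_(w <- ws) tnth (partial_sums (arc_links ws) n) (head o0 w) =
  \sum_(i < 4) tnth n i}%N.
Proof.
do 15! [apply: all_seqP;
  first by rewrite !big_cons big_nil big_ord4 /= ?tnth_add_entry /=; lia].
by [].
Qed.

Lemma circle_prod (A : comNzRingType) (g : nat * int -> A) (x : seq int)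
    (n : 4.-tuple nat) : {in even_circle ++ odd_circle, forall ws,
  \prod_(i < 4) g (tnth (partial_sums (arc_links ws) n) i, x`_i) =
  \prod_(w <- ws) suffix_prod g [seq letter n a | a <- spell x w]}.
Proof.
have add (a b : nat) (y y' : int) : ((a, y) + (b, y') : nat * int) = ((a + b)%N, y + y').
  by [].
do 15! [apply: all_seqP; first by
  rewrite !(big_cons, big_nil) big_ord4 /= ?tnth_add_entry /= ?tnth_add_entry /=
    /letter /= !(big_cons, big_nil) !(addr0, subr0) ?add ?(subr0, subrK); ring].
by [].
Qed.

Definition arc_terms (x : seq int) (circle : seq (seq (seq 'I_4))) : seq (seq int) :=
  flatten [seq [seq args w | w <- words_of_arcs x ws] | ws <- circle].

Lemma mem_arc_terms x circle ws w :
  ws \in circle -> w \in words_of_arcs x ws -> args w \in arc_terms x circle.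
Proof. by move=> wsin win; apply/flatten_mapP; exists ws => //; apply: map_f. Qed.

(** Setting the first argument to 0 keeps exactly the terms whose first exponent
    is 1, the ones that diverge as [z] tends to 1. *)
Definition zero_head (v : seq int) : seq int := 0 :: behead v.

Section Limit.
Context {R : realType}.

Definition arc_weight z (m : 4.-tuple nat) (ws : seq (seq 'I_4)) : R :=
  (descending (arc_links ws) m)%:R * z ^+ (\sum_(w <- ws) tnth m (head o0 w)).

(** Choosing in each factor of the cyclic weight either [z ^+ m_i], which starts
    a new arc at [i], or the descent that continues the previous arc; choosing
    the descent everywhere gives 0. *)
Lemma cyc_weight_arcs z (m : 4.-tuple nat) :
  cyc_weight z m = \sum_(ws <- even_circle) arc_weight z m ws
                 - \sum_(ws <- odd_circle) arc_weight z m ws.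
Proof.
have p0 : ord_pred o0 = o3 by apply: val_inj.
have p1 : ord_pred o1 = o0 by apply: val_inj.
have p2 : ord_pred o2 = o1 by apply: val_inj.
have p3 : ord_pred o3 = o2 by apply: val_inj.
rewrite /cyc_weight big_ord4 p0 p1 p2 p3 !(big_cons, big_nil) /arc_weight.
rewrite !(big_cons, big_nil) /descending /= !addn0 !exprD.
have : ~~ [&& tnth m o0 < tnth m o3, tnth m o1 < tnth m o0,
  tnth m o2 < tnth m o1 & tnth m o3 < tnth m o2]%N by apply/negP; lia.
move: (_ < _)%N (_ < _)%N (_ < _)%N (_ < _)%N => [] [] [] [] //= _; ring.
Qed.

Context (k : nat) (k_gt0 : (0 < k)%N).
Local Notation l := (k + 4)%N.

Definition sum_mzv (v : seq int) : R :=
  \sum_(f : {ffun 'I_4 -> 'I_l.+1} | composition f && (1 < f o0)%N)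
    (\prod_(i < 4) (v`_i)%:~R ^+ (f i).-1) * mzv R (exponents f).

(** The subtraction removes the terms with first exponent 1. *)
Lemma mpl_regularized_cvg v :
  (fun N => mpl k (abel N) v - mpl k (abel N) (zero_head v)) @ \oo --> sum_mzv v.
Proof.
pose c (f : {ffun 'I_4 -> 'I_l.+1}) : R := \prod_(i < 4) (v`_i)%:~R ^+ (f i).-1.
have -> : (fun N => mpl k (abel N) v - mpl k (abel N) (zero_head v)) =
  fun N => \sum_(f <- [seq f <- index_enum _ |
      composition f && (1 < f o0)%N]) c f * polylog (abel N) (exponents f).
  apply/funext => N; rewrite /mpl -sumrB big_filter [RHS]big_mkcondr /=.
  apply: eq_bigr => f fc; rewrite -mulrBl.
  have := composition_gt0 o0 fc; rewrite tnth_mktuple.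
  rewrite /c !big_ord4 /= !nth_behead.
  case: (nat_of_ord (f o0)) => [//|[|n]] _ /=.
    by rewrite !expr0 subrr mul0r.
  by rewrite mulr0z expr0n /= mul0r subr0.
rewrite /sum_mzv -big_filter; apply: cvg_finsum => f.
rewrite mem_filter => /andP[/andP[fc f1] _].
apply: cvgM; first exact: cvg_cst.
apply: polylog_cvg => [i|]; first exact: composition_gt0.
by rewrite tnth_mktuple (_ : ord0 = o0) //; apply: val_inj.
Qed.

(** The complete homogeneous symmetric polynomial of degree [k]. *)
Definition complete_hom (x : seq int) : R :=
  (\prod_(i < 4) geom k 1 (x`_i)%:~R)`_k.

Lemma complete_homE x : complete_hom x =
  \sum_(f : {ffun 'I_4 -> 'I_l.+1} | composition f)
    \prod_(i < 4) (x`_i)%:~R ^+ (f i).-1.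
Proof.
rewrite /complete_hom coef_prod_geom; apply: eq_bigr => f _.
by apply: eq_bigr => i _; rewrite expr1n divr1.
Qed.

Definition gf_coef (x : seq int) (m : 4.-tuple nat) : R :=
  (\prod_(i < 4) geom k (tnth m i)%:R (x`_i)%:~R)`_k.

Lemma gf_coef_ge0 x m : nonneg_ints x -> 0 <= gf_coef x m.
Proof.
move=> x0; rewrite /gf_coef coef_prod_geom_mzv sumr_ge0 // => f _.
by rewrite mulr_ge0 ?prod_nonneg ?mzv_term_ge0.
Qed.

(** Since [k > 0], some exponent is at least 2. *)
Lemma gf_coef_le x (m : 4.-tuple nat) d : nonneg_ints x -> positive_tuples m ->
  (forall i, tnth m d <= tnth m i)%N ->
  gf_coef x m <=
    complete_hom x * ((tnth m d)%:R * \prod_(i < 4) (tnth m i)%:R)^-1.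
Proof.
move=> x0 mpos dmin.
rewrite /gf_coef coef_prod_geom_mzv complete_homE mulr_suml; apply: ler_sum => f fc.
rewrite ler_wpM2l ?prod_nonneg //.
have [j fj] : exists j, (1 < f j)%N.
  apply/existsP; apply: contraT; rewrite negb_exists => /forallP f1.
  have /andP[_ /eqP] := fc; suff : (\sum_i f i <= \sum_(i < 4) 1)%N.
    by rewrite sum1_card card_ord => /[swap] ->; lia.
  by apply: leq_sum => i _; rewrite leqNgt f1.
have := @mzv_term_le R 4 (exponents f) m (fun i => (i == j).+1).
move=> /(_ _ mpos); set c := _^-1 => le; apply: (@le_trans _ _ c).
  apply: le => i; rewrite tnth_mktuple; case: eqP => [->//|_].
  by case/andP: fc => /forallP.
have pos i : 0 < (tnth m i)%:R :> R by rewrite ltr0n mpos.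
have -> : c = ((tnth m j)%:R * \prod_(i < 4) (tnth m i)%:R)^-1.
  rewrite /c; congr (_^-1); rewrite [in LHS](bigD1 j) // [in RHS](bigD1 j) //= eqxx.
  rewrite expr2 -mulrA; congr (_ * (_ * _)); apply: eq_bigr => i /negPf ->.
  by rewrite expr1.
rewrite lef_pV2 ?posrE ?mulr_gt0 ?prodr_gt0 //.
by rewrite ler_wpM2r ?ler_nat // ltW ?prodr_gt0.
Qed.

(** The least entry gained from the coefficient cancels against the one in the
    bound on the cyclic weight. *)
Lemma weighted_dominated z x m : nonneg_ints x -> 0 <= z <= 1 ->
  positive_tuples m ->
  `|cyc_weight z m * gf_coef x m| <= complete_hom x * dominant m.
Proof.
move=> x0 z01 mpos.
have [d dmin] : exists d, forall i, (tnth m d <= tnth m i)%N.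
  exists [arg min_(i < o0) tnth m i]%N.
  by case: arg_minnP => // i _ h j; exact: h.
have [p pmax] : exists p, forall i, (tnth m i <= tnth m p)%N.
  exists [arg max_(i > o0) tnth m i]%N.
  by case: arg_maxnP => // i _ h j; exact: h.
have max_p : max_entry m = tnth m p.
  by apply/eqP; rewrite eqn_leq max_entryP andbT; apply/bigmax_leqP.
have dp i : (tnth m d <= tnth m i <= tnth m p)%N by rewrite dmin pmax.
have h1 := cyc_weight_bound z01 (mpos d) dp.
have h2 := gf_coef_le x0 mpos dmin.
rewrite normrM (ger0_norm (gf_coef_ge0 _ x0)).
apply: (le_trans (ler_pM _ _ h1 h2)); rewrite ?gf_coef_ge0 //.
have pos i : (tnth m i)%:R != 0 :> R by rewrite pnatr_eq0 -lt0n mpos.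
rewrite le_eqVlt /dominant max_p; apply/orP; left; apply/eqP.
have : \prod_(i < 4) (tnth m i)%:R != 0 :> R by apply/prodf_neq0.
move: (\prod_(i < 4) _) => P P0.
by field; rewrite P0 !pos.
Qed.

Definition constant_tuple (m : 4.-tuple nat) : bool :=
  [forall i, tnth m i == tnth m ord0].

Lemma gf_coef_constant x (t : 1.-tuple nat) :
  gf_coef x [tuple of nseq 4 (tnth t ord0)] =
  complete_hom x * mzv_term R [tuple l] t.
Proof.
rewrite /gf_coef coef_prod_geom_mzv complete_homE mulr_suml.
apply: eq_bigr => f /andP[_ /eqP sf]; congr (_ * _).
rewrite /mzv_term big_ord1 prodfV; congr (_^-1).
have -> : tnth [tuple l] ord0 = (\sum_i f i)%N by rewrite sf.
rewrite -prodrXr.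
apply: eq_bigr => i _; rewrite tnth_mktuple; congr (_%:R ^+ _).
by rewrite (tnth_nth 0%N) nth_nseq ltn_ord.
Qed.

(** On the diagonal the coefficient is homogeneous, so a single zeta value
    remains. *)
Lemma hsum_diagonal x s : nonneg_ints x ->
  hsum positive_tuples (fun m => (constant_tuple m)%:R * gf_coef x m) s ->
  s = complete_hom x * zeta R l.
Proof.
move=> x0 hs.
have : hsum (positive_tuples `&` [set m | constant_tuple m]) (gf_coef x) s.
  by apply/hsum_restrict; apply: hsum_ext hs => m _; rewrite mem_setE.
have bij : set_bij (@mzv_index 1) (positive_tuples `&` [set m | constant_tuple m])
    (fun t => [tuple of nseq 4 (tnth t ord0)]).
  split.
  - move=> t /mzv_index_positive tpos; split=> [i|].
      by rewrite (tnth_nth 0%N) nth_nseq ltn_ord.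
    by apply/forallP => i; rewrite !(tnth_nth 0%N) !nth_nseq ltn_ord.
  - move=> t u _ _ /(congr1 (fun m => tnth m ord0)).
    rewrite !(tnth_nth 0%N) /= => E; apply: eq_from_tnth => i.
    by rewrite (ord1 i) !(tnth_nth 0%N).
  - move=> m [mpos /forallP mc]; exists [tuple tnth m ord0].
      by split=> //=; rewrite mpos.
    apply: eq_from_tnth => i; rewrite (eqP (mc i)) (tnth_nth 0%N) nth_nseq ltn_ord.
    by rewrite (tnth_nth 0%N).
rewrite (hsum_reindex _ _ bij) => h.
have {h} : hsum (@mzv_index 1) (fun t => complete_hom x * mzv_term R [tuple l] t) s.
  by apply: hsum_ext h => t _ /=; exact: gf_coef_constant.
have c0 : 0 <= complete_hom x.
  by rewrite complete_homE sumr_ge0 // => f _; exact: prod_nonneg.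
have [->|c_neq0] := eqVneq (complete_hom x) 0 => h.
  rewrite mul0r; apply: hsum_uniq (hsum0 (@mzv_index 1)).
  by apply: hsum_ext h => t _; rewrite mul0r.
have h' : hsum (@mzv_index 1) (mzv_term R [tuple l]) ((complete_hom x)^-1 * s).
  have := hsumZ (c := (complete_hom x)^-1) _ h; rewrite invr_ge0 => /(_ c0).
  by apply: hsum_ext => t _; rewrite mulKf.
by rewrite /zeta /mzv -(hsum_esum h') mulVKf.
Qed.

(** The two sides are the limits, as [z] tends to 1, of the two evaluations of the
    sum of the cyclic weight. The permutation hypothesis says that the terms
    with first exponent 1 cancel, which allows subtracting them before passing
    to the limit. *)
Theorem cyclic_sum_formula (x : seq int) : nonneg_ints x ->
  all nonneg_ints (arc_terms x even_circle ++ arc_terms x odd_circle) ->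
  perm_eq (map zero_head (arc_terms x even_circle))
          (map zero_head (arc_terms x odd_circle)) ->
  \sum_(v <- arc_terms x even_circle) sum_mzv v
  - \sum_(v <- arc_terms x odd_circle) sum_mzv v = complete_hom x * zeta R l.
Proof.
move=> x0 nonneg_args cancel.
pose part circle N := \sum_(v <- arc_terms x circle) mpl k (abel N : R) v.
have z01 N := @abel_ge0_le1 R N.
have z01' N : 0 <= (abel N : R) < 1.
  by have /andP[-> _] := z01 N; rewrite abel_lt1.
have hsum_part circle N : {subset circle <= even_circle ++ odd_circle} ->
    hsum positive_tuples (fun m => (\sum_(ws <- circle) arc_weight (abel N) m ws) *
      gf_coef x m) (part circle N).
  move=> sub; rewrite /part /arc_terms big_flatten /= big_map.
  apply: (hsum_ext (f := fun m => \sum_(ws <- circle)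
      arc_weight (abel N) m ws * gf_coef x m)).
    by move=> m _; rewrite mulr_suml.
  apply: hsum_sum => ws /sub wsin; rewrite big_map.
  have [chained_ws perm_ws] := circle_links wsin.
  apply: hsum_ext (@hsum_arcs R k (abel N) x ws (z01' N) chained_ws perm_ws _ _ _).
  - by move=> m _; rewrite mulrA.
  - by move=> n; exact: circle_heads.
  - by move=> A g n; exact: circle_prod.
  - apply/allP => w win; apply: (allP nonneg_args).
    move: wsin; rewrite [args w \in _]mem_cat.
    by rewrite [ws \in _](mem_cat ws even_circle odd_circle) => /orP[] wsin;
      rewrite (mem_arc_terms wsin win) ?orbT.
have [d hd] : exists d, hsum positive_tuples
    (fun m : 4.-tuple nat => complete_hom x * dominant m) d.
  have [d hd] := @hsum_dominant R.
  have [t ht _] := hsum_subset (@subsetT _ positive_tuples) hd.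
  exists (complete_hom x * t); apply: (hsumZ _ ht).
  by rewrite complete_homE sumr_ge0 // => f _; exact: prod_nonneg.
(* Dominated convergence is about nonnegative families; adding the dominating
   family to the signed one makes it nonnegative. *)
pose U N m := complete_hom x * dominant m + cyc_weight (abel N) m * gf_coef x m.
have U_bound N m : positive_tuples m ->
    0 <= U N m <= complete_hom x * dominant m + complete_hom x * dominant m.
  move=> mpos; have := weighted_dominated x0 (z01 N) mpos.
  by rewrite ler_norml /U => /andP[lo hi]; apply/andP; split; lra.
have hsum_U N : hsum positive_tuples (U N) (d + (part even_circle N - part odd_circle N)).
  have [u hu _] := hsum_dom (U_bound N) (hsumD hd hd).
  have he := hsum_part even_circle N (fun ws (wsin : ws \in even_circle) =>
    (etrans (mem_cat ws even_circle odd_circle) (introT orP (or_introl wsin)))).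
  have ho := hsum_part odd_circle N (fun ws (wsin : ws \in odd_circle) =>
    (etrans (mem_cat ws even_circle odd_circle) (introT orP (or_intror wsin)))).
  have E : u + part odd_circle N = d + part even_circle N.
    apply: hsum_uniq (hsumD hu ho) _; apply: hsum_ext (hsumD hd he) => m _.
    by rewrite /U cyc_weight_arcs; ring.
  by rewrite addrA -E addrK.
have [||s hs cvg_s] := @hsum_dominated R _ positive_tuples U
  (fun m => complete_hom x * dominant m + (constant_tuple m)%:R * gf_coef x m)
  _ _ _ _ _ (hsumD hd hd) hsum_U.
- move=> m _; apply: cvgD; first exact: cvg_cst.
  by apply: cvgM; [exact: cyc_weight_cvg|exact: cvg_cst].
- by move=> N m; exact: U_bound.
have c0 : 0 <= complete_hom x.
  by rewrite complete_homE sumr_ge0 // => f _; exact: prod_nonneg.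
have [m _|e he _] := @hsum_dom R _ positive_tuples
    (fun m => (constant_tuple m)%:R * gf_coef x m) _ _ _ hs.
  by rewrite mulr_ge0 ?gf_coef_ge0 //= lerDr mulr_ge0 ?dominant_ge0.
have es : s = d + complete_hom x * zeta R l.
  by rewrite -(hsum_diagonal x0 he); apply: hsum_uniq hs (hsumD hd he).
rewrite {}es {hs} in cvg_s.
have cvg1 : (fun N => part even_circle N - part odd_circle N) @ \oo -->
    complete_hom x * zeta R l.
  have -> : complete_hom x * zeta R l = d + complete_hom x * zeta R l - d by ring.
  have -> : (fun N => part even_circle N - part odd_circle N) =
      fun N => d + (part even_circle N - part odd_circle N) - d.
    by apply/funext => N; ring.
  by apply: cvgB; [exact: cvg_s|exact: cvg_cst].
apply: (cvg_unique _ _ cvg1) => //.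
have -> : (fun N => part even_circle N - part odd_circle N) =
  fun N => \sum_(v <- arc_terms x even_circle)
             (mpl k (abel N) v - mpl k (abel N) (zero_head v))
         - \sum_(v <- arc_terms x odd_circle)
             (mpl k (abel N) v - mpl k (abel N) (zero_head v)).
  apply/funext => N; rewrite /part !sumrB.
  rewrite -[X in _ - X - _](big_map zero_head xpredT (mpl k (abel N))).
  rewrite -[X in _ - (_ - X)](big_map zero_head xpredT (mpl k (abel N))).
  by rewrite (perm_big _ cancel) /=; ring.
by apply: cvgB; apply: cvg_finsum => v _; exact: mpl_regularized_cvg.
Qed.

End Limit.

(** * Numerical parameters *)

Definition expand (L : seq (nat * seq int)) : seq (seq int) :=
  flatten [seq nseq p.1 p.2 | p <- L].

Lemma sum_expand (R : nzRingType) (F : seq int -> R) L :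
  \sum_(v <- expand L) F v = \sum_(p <- L) p.1%:R * F p.2.
Proof.
rewrite big_flatten big_map; apply: eq_bigr => p _.
by rewrite big_nseq iter_addr_0 mulr_natl.
Qed.

(** For numerical parameters the hypotheses of the cyclic sum formula are
    decidable. The last condition compares multisets: it moves the terms of
    negative sign to the other side, and drops those whose first argument is 0,
    as their first exponent would have to be 1. *)
Definition collects (x : seq int) (E1 E2 : seq (nat * seq int)) : bool :=
  let even := arc_terms x even_circle in
  let odd := arc_terms x odd_circle in
  [&& nonneg_ints x, all nonneg_ints (even ++ odd),
      perm_eq (map zero_head even) (map zero_head odd) &
      perm_eq ([seq v <- even | v`_0 != 0] ++ expand E2)
              ([seq v <- odd | v`_0 != 0] ++ expand E1)].

Section Specialization.
Context {R : realType} (k : nat).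
Local Notation l := (k + 4)%N.

Lemma sum_quadE (F : nat -> nat -> nat -> nat -> R) :
  sum_quad l F =
  \sum_(f : {ffun 'I_4 -> 'I_l.+1} | composition f && (1 < f o0)%N)
     F (f o0) (f o1) (f o2) (f o3).
Proof.
rewrite /sum_quad pair_bigA /= pair_bigA /= pair_big_dep /=.
pose h (p : 'I_l.+1 * 'I_l.+1 * 'I_l.+1 * 'I_l.+1) : {ffun 'I_4 -> 'I_l.+1} :=
  [ffun i => tnth [tuple p.1.1.1; p.1.1.2; p.1.2; p.2] i].
rewrite (reindex h) /=; last first.
  exists (fun f => (f o0, f o1, f o2, f o3)) => [p _|f _].
    by case: p => [[[a b] c] d]; rewrite !ffunE.
  by apply/ffunP; apply: ord4P; rewrite ffunE.
apply: eq_big => [p|p _]; last by rewrite !ffunE.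
rewrite /composition.
have -> : [forall i, 0 < h p i]%N =
    [&& 0 < p.1.1.1, 0 < p.1.1.2, 0 < p.1.2 & 0 < p.2]%N.
  apply/forallP/and4P => [H|[a0 b0 c0 d0]]; last first.
    by apply: (@ord4P (fun i => 0 < h p i)%N); rewrite ffunE.
  by have := (H o0, H o1, H o2, H o3); rewrite !ffunE => -[[[]]].
rewrite big_ord4 !ffunE !(tnth_nth p.2) /=.
by rewrite !addnA; lia.
Qed.

Lemma sum_mzv_head0 v : v`_0 = 0 -> sum_mzv k v = 0 :> R.
Proof.
move=> v0; rewrite /sum_mzv big1 // => f /andP[_ f1].
rewrite big_ord4 v0 mulr0z expr0n.
by case: (nat_of_ord (f o0)) f1 => [|[|n]] //= _; rewrite !mul0r.
Qed.

(** Multiplication by the geometric series takes partial sums of coefficients. *)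
Lemma coef_mul_geom1 (P : {poly R}) (phi psi : nat -> R) :
  (forall i, (i <= k)%N -> P`_i = phi i) ->
  psi 0%N = phi 0%N -> (forall i, psi i.+1 = psi i + phi i.+1) ->
  forall i, (i <= k)%N -> (P * geom k 1 1)`_i = psi i.
Proof.
move=> Pphi psi0 psiS i ik.
have -> : psi i = \sum_(j < i.+1) phi j.
  elim: i {ik} => [|i IH]; first by rewrite big_ord1.
  by rewrite psiS IH [RHS]big_ord_recr.
rewrite coefM; apply: eq_bigr => j _; have ji := ltn_ord j.
rewrite coef_geom (leq_trans (leq_subr _ _) ik) !expr1n divr1 !mulr1 Pphi //.
exact: leq_trans ik.
Qed.

Lemma geom10 : geom k 1 0 = 1 :> {poly R}.
Proof.
apply/polyP => i; rewrite coef_geom expr1n divr1 coefC expr0n.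
by case: i => [|i] /=; rewrite ?mulr0 ?mulr1.
Qed.

Lemma coef_geom1 i : (i <= k)%N -> (geom k 1 1 : {poly R})`_i = 1.
Proof. by move=> ik; rewrite coef_geom ik !expr1n divr1 mulr1. Qed.

Lemma coef_geom1_sq i : (i <= k)%N ->
  (geom k 1 1 * geom k 1 1 : {poly R})`_i = i%:R + 1.
Proof.
apply: (coef_mul_geom1 (phi := fun=> 1) (psi := fun i => i%:R + 1)) => [||j].
- exact: coef_geom1.
- by rewrite add0r.
by rewrite -natr1.
Qed.

Lemma coef_geom1_cube i : (i <= k)%N ->
  (geom k 1 1 * geom k 1 1 * geom k 1 1 : {poly R})`_i =
  (i%:R + 1) * (i%:R + 2) / 2.
Proof.
apply: (coef_mul_geom1 (phi := fun i => i%:R + 1)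
  (psi := fun i => (i%:R + 1) * (i%:R + 2) / 2)) => [||j].
- exact: coef_geom1_sq.
- by field.
by rewrite -natr1; field.
Qed.

Lemma coef_geom1_fourth i : (i <= k)%N ->
  (geom k 1 1 * geom k 1 1 * geom k 1 1 * geom k 1 1 : {poly R})`_i =
  (i%:R + 1) * (i%:R + 2) * (i%:R + 3) / 6.
Proof.
apply: (coef_mul_geom1 (phi := fun i => (i%:R + 1) * (i%:R + 2) / 2)
  (psi := fun i => (i%:R + 1) * (i%:R + 2) * (i%:R + 3) / 6)) => [||j].
- exact: coef_geom1_cube.
- by field.
by rewrite -natr1; field.
Qed.

Context (k_gt0 : (0 < k)%N).

Lemma collected_sum x E1 E2 : collects x E1 E2 ->
  \sum_(p <- E1) p.1%:R * sum_mzv k p.2 - \sum_(p <- E2) p.1%:R * sum_mzv k p.2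
  = complete_hom k x * zeta R l.
Proof.
move=> /and4P[x0 nn cancel E].
rewrite -(cyclic_sum_formula k_gt0 x0 nn cancel) -!sum_expand.
move: (arc_terms x even_circle) (arc_terms x odd_circle) E => even odd E.
have drop0 s : \sum_(v <- s) sum_mzv k v =
    \sum_(v <- [seq v <- s | v`_0 != 0]) sum_mzv k v :> R.
  rewrite big_filter [RHS]big_mkcond; apply: eq_bigr => v _.
  by case: eqP => // /sum_mzv_head0.
rewrite (drop0 even) (drop0 odd).
have := perm_big _ E (op := +%R) (F := fun v => sum_mzv k v : R) (P := xpredT) (x := 0).
rewrite !big_cat /= => h.
by apply/eqP; rewrite subr_eq addrAC eq_sym subr_eq h addrC.
Qed.

Local Notation S4 a b c d := (sum_mzv k [:: a; b; c; d] : R).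

Lemma sum_1000 : S4 1 1 1 1 = zeta R l.
Proof.
have /collected_sum : collects [:: 1; 0; 0; 0] [:: (1%N, [:: 1; 1; 1; 1])] [::].
  by vm_compute.
rewrite !(big_cons, big_nil) /complete_hom big_ord4 /= !(mulr1z, mulr0z) !geom10.
rewrite !mulr1 coef_geom1 //; lra.
Qed.

Lemma sum_1100 :
  2 * S4 2 2 2 1 + S4 2 2 1 1 + S4 2 1 1 1
  - (3 * S4 1 1 1 1 + S4 1 2 1 1 + 2 * S4 1 2 2 1) = (k%:R + 1) * zeta R l.
Proof.
have /collected_sum : collects [:: 1; 1; 0; 0]
  [:: (2%N, [:: 2; 2; 2; 1]); (1%N, [:: 2; 2; 1; 1]); (1%N, [:: 2; 1; 1; 1])]
  [:: (3%N, [:: 1; 1; 1; 1]); (1%N, [:: 1; 2; 1; 1]); (2%N, [:: 1; 2; 2; 1])].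
  by vm_compute.
rewrite !(big_cons, big_nil) /complete_hom big_ord4 /= !(mulr1z, mulr0z) !geom10.
rewrite !mulr1 coef_geom1_sq //; lra.
Qed.

Lemma sum_1010 :
  2 * S4 2 2 1 1 + 4 * S4 2 2 2 1
  - (4 * S4 1 1 2 1 + 2 * S4 1 2 1 1 + 4 * S4 1 2 2 1) = (k%:R + 1) * zeta R l.
Proof.
have /collected_sum : collects [:: 1; 0; 1; 0]
  [:: (2%N, [:: 2; 2; 1; 1]); (4%N, [:: 2; 2; 2; 1])]
  [:: (4%N, [:: 1; 1; 2; 1]); (2%N, [:: 1; 2; 1; 1]); (4%N, [:: 1; 2; 2; 1])].
  by vm_compute.
rewrite !(big_cons, big_nil) /complete_hom big_ord4 /= !(mulr1z, mulr0z) !geom10.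
rewrite !(mulr1, mul1r) coef_geom1_sq //; lra.
Qed.

Lemma sum_1110 :
  2 * S4 3 2 1 1 + 4 * S4 3 2 2 1 + 6 * S4 3 3 2 1
  + 3 * S4 1 1 1 1 + 2 * S4 1 2 1 1 + 4 * S4 1 2 2 1 + 2 * S4 1 1 2 1
  - (2 * S4 2 1 2 1 + 6 * S4 2 3 2 1 + 4 * S4 2 2 1 1 + 2 * S4 2 1 1 1 + 8 * S4 2 2 2 1)
  = (k%:R + 1) * (k%:R + 2) / 2 * zeta R l.
Proof.
have /collected_sum : collects [:: 1; 1; 1; 0]
  [:: (2%N, [:: 3; 2; 1; 1]); (4%N, [:: 3; 2; 2; 1]); (6%N, [:: 3; 3; 2; 1]);
      (3%N, [:: 1; 1; 1; 1]); (2%N, [:: 1; 2; 1; 1]); (4%N, [:: 1; 2; 2; 1]);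
      (2%N, [:: 1; 1; 2; 1])]
  [:: (2%N, [:: 2; 1; 2; 1]); (6%N, [:: 2; 3; 2; 1]); (4%N, [:: 2; 2; 1; 1]);
      (2%N, [:: 2; 1; 1; 1]); (8%N, [:: 2; 2; 2; 1])].
  by vm_compute.
rewrite !(big_cons, big_nil) /complete_hom big_ord4 /= !(mulr1z, mulr0z) !geom10.
rewrite !mulr1 !mulrA coef_geom1_cube //; lra.
Qed.

Lemma sum_1111 :
  24 * S4 4 3 2 1 + 4 * S4 2 1 1 1 + 8 * S4 2 2 1 1 + 16 * S4 2 2 2 1
  - (8 * S4 3 2 1 1 + 16 * S4 3 2 2 1 + 24 * S4 3 3 2 1 + 4 * S4 1 1 1 1)
  = (k%:R + 1) * (k%:R + 2) * (k%:R + 3) / 6 * zeta R l.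
Proof.
have /collected_sum : collects [:: 1; 1; 1; 1]
  [:: (24%N, [:: 4; 3; 2; 1]); (4%N, [:: 2; 1; 1; 1]); (8%N, [:: 2; 2; 1; 1]);
      (16%N, [:: 2; 2; 2; 1])]
  [:: (8%N, [:: 3; 2; 1; 1]); (16%N, [:: 3; 2; 2; 1]); (24%N, [:: 3; 3; 2; 1]);
      (4%N, [:: 1; 1; 1; 1])].
  by vm_compute.
rewrite !(big_cons, big_nil) /complete_hom big_ord4 /= !(mulr1z, mulr0z).
rewrite !mulrA coef_geom1_fourth //; lra.
Qed.

End Specialization.

(** * The four weighted sums *)

Section Weights.
Context {R : realType} (k : nat).
Local Notation l := (k + 4)%N.
Local Notation S4 a b c d := (sum_mzv k [:: a; b; c; d] : R).

Definition sum_exponents (F : nat -> nat -> nat -> nat -> R) : R :=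
  \sum_(f : {ffun 'I_4 -> 'I_l.+1} | composition f && (1 < f o0)%N)
    F (f o0).-1 (f o1).-1 (f o2).-1 (f o3).-1.

Lemma sum_quad_exponents F : sum_quad l F =
  sum_exponents (fun a b c d => F a.+1 b.+1 c.+1 d.+1) :> R.
Proof.
rewrite sum_quadE /sum_exponents; apply: eq_bigr => f /andP[/andP[/forallP fpos _] _].
by rewrite !prednK.
Qed.

Lemma sum_mzv4E (x y z t : int) : S4 x y z t = sum_exponents (fun a b c d =>
  x%:~R ^+ a * y%:~R ^+ b * z%:~R ^+ c * t%:~R ^+ d *
  mzv R [tuple a.+1; b.+1; c.+1; d.+1]).
Proof.
rewrite /sum_mzv /sum_exponents; apply: eq_bigr => f /andP[/andP[/forallP fpos _] _].
by rewrite big_ord4 /= !mulrA /exponents mktuple4 !prednK.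
Qed.

(** Each weight of the four identities is a combination of monomials
    [x ^ (l1 - 1) * y ^ (l2 - 1) * z ^ (l3 - 1)]. *)
Ltac match_weights :=
  rewrite sum_quad_exponents !sum_mzv4E /sum_exponents
    ?mulr_sumr -?sumrN -?big_split /=;
  let f := fresh in apply: eq_bigr => f _;
  move: (f o0).-1 (f o1).-1 (f o2).-1 (f o3).-1 => a b c d;
  rewrite ?mulr1z ?expr1n.

Lemma weight1 :
  sum_quad l (fun l1 l2 l3 l4 => mzv R [tuple l1; l2; l3; l4]) = S4 1 1 1 1.
Proof. by match_weights; ring. Qed.

Lemma weight2 :
  sum_quad l (fun l1 l2 l3 l4 =>
    (2 ^+ (l1 + l2 + l3 - 2)%N + 2 ^+ (l1 + l2 - 2)%N + 2 ^+ (l1 - 1)%N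
       - 2 ^+ (l2 + l3 - 1)%N - 2 ^+ (l2 - 1)%N)
    * mzv R [tuple l1; l2; l3; l4])
  = 2 * S4 2 2 2 1 + S4 2 2 1 1 + S4 2 1 1 1 - 2 * S4 1 2 2 1 - S4 1 2 1 1.
Proof.
match_weights.
have -> : (a.+1 + b.+1 + c.+1 - 2 = a + b + c.+1)%N by lia.
have -> : (a.+1 + b.+1 - 2 = a + b)%N by lia.
have -> : (b.+1 + c.+1 - 1 = b + c.+1)%N by lia.
by rewrite !subn1 /= !exprD !exprS; ring.
Qed.

Lemma weight3 :
  sum_quad l (fun l1 l2 l3 l4 =>
    (2 ^+ l1 + 2 ^+ (l3 + 1)%N) * mzv R [tuple l1; l2; l3; l4])
  = 2 * S4 2 1 1 1 + 4 * S4 1 1 2 1.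
Proof. by match_weights; rewrite addn1 !exprS; ring. Qed.

Lemma weight4 :
  sum_quad l (fun l1 l2 l3 l4 =>
    (3 ^+ l2 * 2 ^+ (l1 - 1)%N - 3 ^+ l2 - 1) * 2 ^+ (l1 + l3)%N
    * mzv R [tuple l1; l2; l3; l4])
  = 12 * S4 4 3 2 1 - 12 * S4 2 3 2 1 - 4 * S4 2 1 2 1.
Proof.
match_weights; rewrite subn1 /= !exprD !exprS.
have -> : 4%:~R ^+ a = 2 ^+ a * 2 ^+ a :> R.
  by rewrite -exprMn; congr (_ ^+ a); ring.
ring.
Qed.

End Weights.

Theorem corollary1p2 (R : realType) (l : nat) (hl : (4 < l)%N) :
  [/\ sum_quad l (fun l1 l2 l3 l4 => mzv R [tuple l1; l2; l3; l4])
        = zeta R l,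
      sum_quad l (fun l1 l2 l3 l4 =>
          (2 ^+ (l1 + l2 + l3 - 2)%N + 2 ^+ (l1 + l2 - 2)%N + 2 ^+ (l1 - 1)%N
             - 2 ^+ (l2 + l3 - 1)%N - 2 ^+ (l2 - 1)%N)
          * mzv R [tuple l1; l2; l3; l4])
        = l%:R * zeta R l,
      sum_quad l (fun l1 l2 l3 l4 =>
          (2 ^+ l1 + 2 ^+ (l3 + 1)%N) * mzv R [tuple l1; l2; l3; l4])
        = (l%:R + 3) * zeta R l
    & sum_quad l (fun l1 l2 l3 l4 =>
          (3 ^+ l2 * 2 ^+ (l1 - 1)%N - 3 ^+ l2 - 1) * 2 ^+ (l1 + l3)%N
          * mzv R [tuple l1; l2; l3; l4])
        = ((l%:R + 7) * (l%:R + 2) * (l%:R - 3) / 12 + 2) * zeta R l].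
Proof.
have [k k_gt0 ->] : exists2 k, (0 < k)%N & l = (k + 4)%N.
  by exists (l - 4)%N; rewrite ?subn_gt0 // subnK // ltnW.
rewrite weight1 weight2 weight3 weight4 natrD.
have e1 := @sum_1000 R k k_gt0; have e2 := @sum_1100 R k k_gt0.
have e3 := @sum_1010 R k k_gt0; have e4 := @sum_1110 R k k_gt0.
have e5 := @sum_1111 R k k_gt0.
split; lra.
Qed.
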